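(* Let $k$ be a field and $A=k[x_1,\ldots,x_d]$ the polynomial Hopf algebra. A linear map $q:A\to A\otimes A$ gives a co-Poisson coalgebra structure on $A$ if and only if there is a linear map $I:A\to A\otimes A$ such that for all monic monomials $a\in A$: (1) $q(a)=\sum I(a_1)\Delta(a_2)$; (2) $I(a)=\sum_{1\le i,j\le d}\lambda_a^{ij}\,x_i\otimes x_j\in\mathcal{I}$ with $(\lambda_a^{ij})_{d\times d}\in M_d(k)$ skew-symmetric; (3) for all $1\le i<j<m\le d$, $$\sum\sum_{s=1}^d\left(\lambda_{a_1}^{sm}\lambda_{x_sa_2}^{ij}+\lambda_{a_1}^{si}\lambda_{x_sa_2}^{jm}+\lambda_{a_1}^{sj}\lambda_{x_sa_2}^{mi}\right)=0,$$ where the outer sum is over $\Delta(a)=\sum a_1\otimes a_2$.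
   Context: $A=k[x_1,\ldots,x_d]$ is the Hopf algebra (universal enveloping algebra of the $d$-dimensional abelian Lie algebra) whose comultiplication $\Delta$ is the algebra map with $\Delta(x_i)=x_i\otimes1+1\otimes x_i$. Sweedler notation: $\Delta(a)=\sum a_1\otimes a_2$; products are taken in the algebra $A\otimes A$. $\mathcal{I}=\bigoplus_{i<j}k(x_i\otimes x_j-x_j\otimes x_i)\subseteq A\otimes A$. The coefficients $\lambda^{ij}_b$ for general $b\in A$ are defined by linear extension in $b$, i.e. $I(b)=\sum_{i,j}\lambda_b^{ij}x_i\otimes x_j$. $t_n:V^{\otimes n}\to V^{\otimes n}$ is $v_1\otimes\cdots\otimes v_n\mapsto v_n\otimes v_1\otimes\cdots\otimes v_{n-1}$. A linear map $q:C\to C\otimes C$ on a coalgebra $(C,\Delta,\varepsilon)$ gives a co-Poisson coalgebra structure if $(1+t_2)q=0$, $(1+t_3+t_3^2)(q\otimes1)q=0$, and $(\Delta\otimes1)q=(1\otimes q)\Delta-t_3^2(q\otimes1)\Delta$.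
   Formalization: The field k is assumed to have characteristic 0; in characteristic p > 0 with d ≥ 1 the ''only if'' fails, e.g. for q(a) = (x_1^p⊗x_1 − x_1⊗x_1^p)Δ(a). *)

(* Defs.v *)
From HB Require Import structures.
From mathcomp Require Import all_boot all_algebra.
From mathcomp.multinomials Require Import freeg mpoly.
From mathcomp Require Import boolp.

Set Implicit Arguments.
Unset Strict Implicit.
Unset Printing Implicit Defensive.

Import GRing.Theory.
Local Open Scope ring_scope.
Local Open Scope quotient_scope.

(* The tensor product of two R-modules, as the free module on U * V modulo
   the submodule [tensor_null] generated by the bilinearity relations.
   [boolp] only serves to see that submodule as a boolean predicate, which
   the quotient construction of the library requires. *)

Section TensorProduct.
Context (R : comNzRingType) (U V : lmodType R).
Local Notation F := {freeg (U * V)%type / R}.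

Inductive tensor_null : F -> Prop :=
| tensor_null0 : tensor_null 0
| tensor_nullP c x y :
    tensor_null x -> tensor_null y -> tensor_null (c *: x + y)
| tensor_nullDl u u' v :
    tensor_null (<< (u + u', v) >> - << (u, v) >> - << (u', v) >>)
| tensor_nullDr u v v' :
    tensor_null (<< (u, v + v') >> - << (u, v) >> - << (u, v') >>)
| tensor_nullZl c u v : tensor_null (<< (c *: u, v) >> - c *: << (u, v) >>)
| tensor_nullZr c u v : tensor_null (<< (u, c *: v) >> - c *: << (u, v) >>).

Definition tensor_nullb : {pred F} := fun x => `[< tensor_null x >].

Lemma tensor_nullb_zmod : zmod_closed tensor_nullb.
Proof.
split=> [|x y /asboolP nx /asboolP ny]; first exact/asboolP/tensor_null0.
apply/asboolP; rewrite addrC -scaleN1r.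
exact: tensor_nullP.
Qed.

HB.instance Definition _ :=
  GRing.isZmodClosed.Build F tensor_nullb tensor_nullb_zmod.

Definition tensor := Quotient.quot tensor_nullb.
HB.instance Definition _ := Choice.on tensor.
HB.instance Definition _ := EqQuotient.on tensor.
HB.instance Definition _ := GRing.Zmodule.on tensor.
HB.instance Definition _ :=
  ZmodQuotient.on tensor.

Definition tensor_scale (c : R) (x : tensor) : tensor :=
  \pi_tensor (c *: repr x).

Lemma pi_tensor_eq (x y : F) :
  (\pi_tensor x = \pi_tensor y) <-> tensor_null (x - y).
Proof.
split=> [/eqP|nxy]; first by rewrite piE Quotient.equivE => /asboolP.
by apply/eqP; rewrite piE Quotient.equivE; apply/asboolP.
Qed.

Lemma pi_tensorZ c (x : F) : \pi_tensor (c *: x) = tensor_scale c (\pi x).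
Proof.
apply/pi_tensor_eq; rewrite -scalerBr -[_ *: _]addr0.
apply: tensor_nullP; last exact: tensor_null0.
by apply/pi_tensor_eq; rewrite reprK.
Qed.

Fact tensor_scaleA a b x :
  tensor_scale a (tensor_scale b x) = tensor_scale (a * b) x.
Proof. by elim/quotW: x => x; rewrite -[tensor_scale b _]pi_tensorZ -!pi_tensorZ scalerA. Qed.
Fact tensor_scale1 : left_id 1 tensor_scale.
Proof. by elim/quotW => x; rewrite -!pi_tensorZ scale1r. Qed.
Fact tensor_scaleDr : right_distributive tensor_scale +%R.
Proof.
move=> c; elim/quotW => x; elim/quotW => y.
by rewrite -raddfD -!pi_tensorZ -raddfD scalerDr.
Qed.
Fact tensor_scaleDl x : {morph tensor_scale^~ x : a b / a + b}.
Proof.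
by elim/quotW: x => x a b /=; rewrite -!pi_tensorZ -raddfD scalerDl.
Qed.

HB.instance Definition _ := GRing.Zmodule_isLmodule.Build R tensor
  tensor_scaleA tensor_scale1 tensor_scaleDr tensor_scaleDl.

Definition tclass (x : F) : tensor := \pi_tensor x.

Fact tclass_linear : linear tclass.
Proof.
by move=> c x y; rewrite /tclass raddfD; congr (_ + _); exact: pi_tensorZ.
Qed.
HB.instance Definition _ :=
  GRing.isLinear.Build R F tensor *:%R tclass tclass_linear.

Lemma tclass_eq (x y : F) : tclass x = tclass y <-> tensor_null (x - y).
Proof. exact: pi_tensor_eq. Qed.

Lemma tclassK (x : tensor) : tclass (repr x) = x.
Proof. exact: reprK. Qed.

Definition tens (u : U) (v : V) : tensor := tclass << (u, v) >>.

End TensorProduct.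

Notation "u *t v" := (tens u v) (at level 40, left associativity) : ring_scope.

Section TensorTheory.
Context (R : comNzRingType) (U V : lmodType R).
Implicit Types (u : U) (v : V).
Local Notation F := {freeg (U * V)%type / R}.

Lemma tensDl u u' v : (u + u') *t v = u *t v + u' *t v.
Proof.
rewrite /tens -raddfD; apply/tclass_eq; rewrite opprD addrA.
exact: tensor_nullDl.
Qed.

Lemma tensDr u v v' : u *t (v + v') = u *t v + u *t v'.
Proof.
rewrite /tens -raddfD; apply/tclass_eq; rewrite opprD addrA.
exact: tensor_nullDr.
Qed.

Lemma tensZl c u v : (c *: u) *t v = c *: (u *t v).
Proof. by rewrite /tens -linearZ; apply/tclass_eq/tensor_nullZl. Qed.

Lemma tensZr c u v : u *t (c *: v) = c *: (u *t v).
Proof. by rewrite /tens -linearZ; apply/tclass_eq/tensor_nullZr. Qed.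

Lemma tens0l v : 0 *t v = 0 :> tensor U V.
Proof. by rewrite -(scale0r 0) tensZl scale0r. Qed.

Lemma tens0r u : u *t 0 = 0 :> tensor U V.
Proof. by rewrite -(scale0r 0) tensZr scale0r. Qed.

Lemma freegUZ c (z : U * V) : << c *g z >> = c *: << z >> :> F.
Proof. by apply/eqP/freeg_eqP => w; rewrite coeffZ !coeffU mul1r. Qed.

Lemma freeg_indZ (P : F -> Prop) :
    P 0 -> (forall c z x, P x -> P (c *: << z >> + x)) -> forall x, P x.
Proof.
move=> P0 PD x; rewrite -(freeg_sumE x).
elim: (dom x) => [|z s IHs]; first by rewrite big_nil.
by rewrite big_cons freegUZ; apply: PD.
Qed.

Lemma tensor_ind (P : tensor U V -> Prop) :
    (forall u v, P (u *t v)) ->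
    (forall x y, P x -> P y -> P (x + y)) ->
  forall x, P x.
Proof.
move=> Pt PD x; rewrite -[x]tclassK.
elim/freeg_indZ: (repr x) => [|c [u v] y Py]; first by rewrite raddf0 -(tens0l 0).
rewrite linearP; apply: PD => //=; rewrite -[tclass _]/(u *t v) -tensZl.
exact: Pt.
Qed.

Definition bilin (W : lmodType R) (f : U -> V -> W) : Prop :=
  (forall v, linear (f^~ v)) /\ (forall u, linear (f u)).

Section Lift.
Context (W : lmodType R) (f : U -> V -> W).

(* The linear map induced by f; meaningful only for a bilinear f. *)
Definition tlift (x : tensor U V) : W := fglift (fun p => f p.1 p.2) (repr x).

Hypothesis bf : bilin f.
Let fl : forall v, linear (f^~ v) := bf.1.
Let fr : forall u, linear (f u) := bf.2.

Let linZ (X : lmodType R) (h : X -> W) :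
  linear h -> forall c x, h (c *: x) = c *: h x.
Proof.
move=> lh c x; have h0 : h 0 = 0.
  by apply: (addrI (h 0)); rewrite -{1}[h 0]scale1r -lh scaler0 !addr0.
by rewrite -[c *: x]addr0 lh h0 addr0.
Qed.

Let g : F -> W := fglift (fun p => f p.1 p.2).

Let gD x y : g (x + y) = g x + g y.
Proof.
pose G := GRing.isZmodMorphism.Build _ _ g (lift_is_additive (fun p => f p.1 p.2)).
exact: (raddfD (HB.pack_for {additive F -> W} g G)).
Qed.

Let gU c z : g (c *: << z >>) = c *: f z.1 z.2.
Proof. by rewrite -freegUZ /g liftU. Qed.

Let gP c x y : g (c *: x + y) = c *: g x + g y.
Proof.
rewrite gD; congr (_ + _); elim/freeg_indZ: x => [|b z x IHx].
  have g0 : g 0 = 0 by apply: (addrI (g 0)); rewrite -gD !addr0.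
  by rewrite scaler0 g0 scaler0.
by rewrite scalerDr !gD IHx scalerA !gU scalerDr scalerA.
Qed.

Let g1 z : g << z >> = f z.1 z.2.
Proof. by rewrite -[<< z >>]scale1r gU scale1r. Qed.

Let gN x : g (- x) = - g x.
Proof.
have g0 : g 0 = 0 by apply: (addrI (g 0)); rewrite -gD !addr0.
by apply: (addrI (g x)); rewrite -gD !subrr.
Qed.

Let g_null x : tensor_null x -> g x = 0.
Proof.
elim=> {x} [|c x y _ gx _ gy|u u' v|u v v'|c u v|c u v].
- by apply: (addrI (g 0)); rewrite -gD !addr0.
- by rewrite gP gx gy scaler0 addr0.
- rewrite !gD !gN !g1 /= -[u]scale1r fl !scale1r.
  by rewrite addrAC addrK subrr.
- rewrite !gD !gN !g1 /= -[v]scale1r fr !scale1r.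
  by rewrite addrAC addrK subrr.
- by rewrite gD gN gU !g1 /= (linZ (fl v)) subrr.
by rewrite gD gN gU !g1 /= (linZ (fr u)) subrr.
Qed.

Let gclass x : tlift (tclass x) = g x.
Proof.
rewrite /tlift -/(g _); apply/eqP; rewrite -subr_eq0 -gN -gD; apply/eqP.
by apply/g_null/tclass_eq; rewrite tclassK.
Qed.

Lemma tlift_tens u v : tlift (u *t v) = f u v.
Proof. by rewrite gclass g1. Qed.

Lemma tlift_linear : linear tlift.
Proof.
move=> c x y; rewrite -[x]tclassK -[y]tclassK -linearP !gclass.
exact: gP.
Qed.

Lemma tliftD x y : tlift (x + y) = tlift x + tlift y.
Proof. by have := tlift_linear 1 x y; rewrite !scale1r. Qed.

End Lift.

Lemma tlift_funP (W : lmodType R) (f f1 f2 : U -> V -> W) c x :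
    bilin f -> bilin f1 -> bilin f2 ->
    (forall u v, f u v = c *: f1 u v + f2 u v) ->
  tlift f x = c *: tlift f1 x + tlift f2 x.
Proof.
move=> bf bf1 bf2 ef; elim/tensor_ind: x => [u v|x y IHx IHy].
  by rewrite !tlift_tens.
by rewrite !tliftD // IHx IHy scalerDr addrACA.
Qed.

Lemma bilin_tens : bilin (@tens R U V).
Proof.
by split=> [v|u] c x y; rewrite ?tensDl ?tensDr ?tensZl ?tensZr.
Qed.

Lemma tlift_unique (W : lmodType R) (h1 h2 : tensor U V -> W) :
    linear h1 -> linear h2 -> (forall u v, h1 (u *t v) = h2 (u *t v)) ->
  h1 =1 h2.
Proof.
move=> lh1 lh2 eq_h; apply: tensor_ind => // x y hx hy.
by rewrite -[x]scale1r lh1 lh2 !hx hy.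
Qed.

End TensorTheory.

Section TensorMaps.
Context (R : comNzRingType).

Definition tmap (U V U' V' : lmodType R) (f : U -> U') (g : V -> V') :
  tensor U V -> tensor U' V' := tlift (fun u v => f u *t g v).

Definition tassoc (U V W : lmodType R) :
    tensor U (tensor V W) -> tensor (tensor U V) W :=
  tlift (fun u => tlift (fun v w => (u *t v) *t w)).

Definition t2 (V : lmodType R) : tensor V V -> tensor V V :=
  tlift (fun v1 v2 => v2 *t v1).

(* The third tensor power of V is represented by (V *t V) *t V. *)
Definition t3 (V : lmodType R) :
    tensor (tensor V V) V -> tensor (tensor V V) V :=
  tlift (fun v12 v3 => tlift (fun v1 v2 => (v3 *t v1) *t v2) v12).

Lemma tmap_tens (U V U' V' : lmodType R)
    (f : {linear U -> U'}) (g : {linear V -> V'}) u v :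
  tmap f g (u *t v) = f u *t g v.
Proof.
apply: (tlift_tens (f := fun u v => f u *t g v)).
by split=> [w|w] c x y; rewrite linearP ?(bilin_tens _ _).1 ?(bilin_tens _ _).2.
Qed.

Lemma tassoc_tens (U V W : lmodType R) (u : U) (v : V) (w : W) :
  tassoc (u *t (v *t w)) = (u *t v) *t w.
Proof.
have b x : bilin (fun (v : V) (w : W) => (x : U) *t v *t w).
  by split=> z c y y'; rewrite ?(tensDl, tensZl, tensDr, tensZr).
rewrite /tassoc tlift_tens ?tlift_tens //; split=> [y c u1 u2|x].
  by apply: tlift_funP => // v' w'; rewrite !(tensDl, tensZl).
exact: tlift_linear.
Qed.

Lemma t2_tens (V : lmodType R) (u v : V) : t2 (u *t v) = v *t u.
Proof.
apply: (tlift_tens (f := fun v1 v2 => v2 *t v1)).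
by split=> z c y y'; rewrite ?(tensDl, tensZl, tensDr, tensZr).
Qed.

Lemma t3_tens (V : lmodType R) (u v w : V) :
  t3 ((u *t v) *t w) = (w *t u) *t v.
Proof.
have b x : bilin (fun v1 v2 : V => ((x : V) *t v1) *t v2).
  by split=> z c y y'; rewrite ?(tensDl, tensZl, tensDr, tensZr).
rewrite /t3 tlift_tens ?tlift_tens //; split=> [x|y c u1 u2].
  exact: tlift_linear.
by apply: tlift_funP => // v' w'; rewrite !(tensDl, tensZl).
Qed.

End TensorMaps.

(* q is a co-Poisson structure on the coalgebra C with comultiplication
   Delta. *)
Definition co_poisson (R : comNzRingType) (C : lmodType R)
    (Delta q : {linear C -> tensor C C}) : Prop :=
  [/\ forall a, q a + t2 (q a) = 0,
      forall a, let w := tmap q idfun (q a) in w + t3 w + t3 (t3 w) = 0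
    & forall a, tmap Delta idfun (q a) =
        tassoc (tmap idfun q (Delta a)) - t3 (t3 (tmap q idfun (Delta a)))].

Section TensorAlgebra.
Context (R : comNzRingType) (A : comAlgType R).
Local Notation T := (tensor A A).
Implicit Types (a b : A) (x y z : T).

Definition tensor_mul x y : T :=
  tlift (fun a b => tlift (fun a' b' => (a * a') *t (b * b')) y) x.

Let bin a b : bilin (fun a' b' : A => (a * a') *t (b * b')).
Proof.
by split=> z c y y'; rewrite mulrDr -scalerAr ?(tensDl, tensZl, tensDr, tensZr).
Qed.

Let bout y : bilin (fun a b => tlift (fun a' b' => (a * a') *t (b * b')) y).
Proof.
by split=> z c u u'; apply: tlift_funP => // v w;
  rewrite mulrDl -scalerAl ?(tensDl, tensZl, tensDr, tensZr).
Qed.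

Lemma tensor_mul_tens a b a' b' :
  tensor_mul (a *t b) (a' *t b') = (a * a') *t (b * b').
Proof. by rewrite /tensor_mul !tlift_tens. Qed.

Fact tensor_mulPl y : linear (tensor_mul^~ y).
Proof. exact: tlift_linear. Qed.

Fact tensor_mulC : commutative tensor_mul.
Proof.
have mulDr x y y' : tensor_mul x (y + y') = tensor_mul x y + tensor_mul x y'.
  rewrite -[tensor_mul x y]scale1r; apply: tlift_funP => // a b.
  by rewrite scale1r tliftD.
move=> x y; elim/tensor_ind: x => [a b|x x' IHx IHx']; last first.
  by rewrite mulDr -IHx -IHx'; exact: tliftD.
elim/tensor_ind: y => [a' b'|y y' IHy IHy'].
  by rewrite !tensor_mul_tens mulrC [b * _]mulrC.
by rewrite mulDr IHy IHy'; apply/esym; exact: tliftD.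
Qed.

Fact tensor_mulDl : left_distributive tensor_mul +%R.
Proof. by move=> x y z; exact: tliftD. Qed.

Fact tensor_mulDr : right_distributive tensor_mul +%R.
Proof. by move=> x y z; rewrite !(tensor_mulC x) tensor_mulDl. Qed.

Fact tensor_mulA : associative tensor_mul.
Proof.
move=> x y z; elim/tensor_ind: x => [a b|x x' IH IH']; last first.
  by rewrite !tensor_mulDl IH IH'.
elim/tensor_ind: y => [a' b'|y y' IH IH']; last first.
  by rewrite tensor_mulDl !tensor_mulDr tensor_mulDl IH IH'.
elim/tensor_ind: z => [a'' b''|z z' IH IH']; last first.
  by rewrite !tensor_mulDr IH IH'.
by rewrite !tensor_mul_tens !mulrA.
Qed.

Fact tensor_mul1 : left_id (1 *t 1) tensor_mul.
Proof.
elim/tensor_ind=> [a b|x y IHx IHy]; first by rewrite tensor_mul_tens !mul1r.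
by rewrite tensor_mulDr IHx IHy.
Qed.

(* The multiplication map of A sends 1 *t 1 to 1. *)
Fact tensor_1_neq0 : 1 *t 1 != 0 :> T.
Proof.
have bm : bilin (fun a b : A => a * b).
  by split=> z c u v; rewrite (mulrDl, mulrDr) -?scalerAl -?scalerAr.
apply/eqP => /(congr1 (tlift (fun a b : A => a * b))).
rewrite -[in RHS](tens0l A (1 : A)) !tlift_tens // mul0r mulr1.
exact/eqP/oner_neq0.
Qed.

HB.instance Definition _ := GRing.Zmodule_isComNzRing.Build T
  tensor_mulA tensor_mulC tensor_mul1 tensor_mulDl tensor_1_neq0.

Fact tensor_scalerAl c x y : c *: (x * y) = (c *: x) * y.
Proof.
have := tensor_mulPl y c x 0.
by rewrite addr0 -/(_ * _) -[tensor_mul 0 y]/(0 * y) mul0r addr0.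
Qed.

HB.instance Definition _ :=
  GRing.Lmodule_isLalgebra.Build R T tensor_scalerAl.

Fact tensor_scalerAr c x y : c *: (x * y) = x * (c *: y).
Proof. by rewrite mulrC tensor_scalerAl mulrC. Qed.

HB.instance Definition _ :=
  GRing.Lalgebra_isAlgebra.Build R T tensor_scalerAr.

Lemma tensM a b a' b' : (a *t b) * (a' *t b') = (a * a') *t (b * b') :> T.
Proof. exact: tensor_mul_tens. Qed.

End TensorAlgebra.

Section PolynomialHopf.
Context (k : fieldType) (d : nat).
Local Notation A := {mpoly k[d]}.

(* The algebra map A -> A *t A with x_i |-> x_i *t 1 + 1 *t x_i. *)
Definition Delta : A -> tensor A A :=
  mmap (in_alg (tensor A A)) (fun i => 'X_i *t 1 + 1 *t 'X_i).

Fact Delta_scalable : scalable Delta.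
Proof. by move=> c p; rewrite /Delta mmapZ mulr_algl. Qed.

HB.instance Definition _ := GRing.RMorphism.on Delta.
HB.instance Definition _ :=
  GRing.isScalable.Build k A (tensor A A) *:%R Delta Delta_scalable.

Lemma DeltaX i : Delta 'X_i = 'X_i *t 1 + 1 *t 'X_i.
Proof. by rewrite /Delta mmapX mmap1U. Qed.

(* [sweedler F a] is the sum over (a) of F a_1 a_2, for a bilinear F. *)
Definition sweedler (W : lmodType k) (F : A -> A -> W) (a : A) : W :=
  tlift F (Delta a).

Definition calI (T : tensor A A) : Prop :=
  exists c : 'I_d -> 'I_d -> k,
    T = \sum_(i < d) \sum_(j < d | (i < j)%N)
          c i j *: ('X_i *t 'X_j - 'X_j *t 'X_i).

End PolynomialHopf.

(* Main.v *)
Require Import Defs.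
From HB Require Import structures.
From mathcomp Require Import all_boot all_algebra ring.
From mathcomp.multinomials Require Import freeg mpoly.
From mathcomp Require Import boolp.

(** Linear maps from the polynomial algebra [A] to a commutative algebra [B] form a
    commutative ring under convolution, [f * g = (a |-> sum f a_1 * g a_2)]. An algebra
    map is invertible in this ring, its inverse being its composite with the antipode, and
    composition with an algebra map [B -> B'] is a ring morphism. Condition (1) reads
    [q = I * Delta], so that [I] exists and is [q * Delta^-1] ([deconv]); what has to be
    compared are the properties of [q] and those of [I].

    The identities in the third tensor power are evaluated at triples of algebra maps
    [j1], [j2], [j3] from [A] to [B], through [u (x) v (x) w |-> j1 u * j2 v * j3 w]: the
    cyclic rotation then only permutes the three maps, and some triple is injective
    ([tpair3_inj]). For instance [Delta] becomes [j1 * j2] on two factors. Dividing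
    the co-Leibniz identity by [j1 * j2 * j3] leaves the statement that [I],
    being skew-symmetric, is primitive in its first argument ([deconv_coleibniz]);
    conversely this holds whenever [I] is skew-symmetric and takes values in
    the span of the [x_i (x) x_j] ([coleibniz_q]).
    Skew-symmetry passes between [q] and [I] since [Delta] is cocommutative.

    Primitivity is exploited by multiplying the two factors of [Delta] together: the
    algebra endomorphism [x_i |-> 2 x_i], applied to the first factor of [I a], doubles
    [I a]. It multiplies monomials of degree [n] by [2 ^ n], so that in characteristic
    zero only degree one survives in the first factor, and by skew-symmetry in the second
    ([primitive_decomp]). This gives the coefficients lambda.

    Finally, with [L i j] the linear form lambda^ij and [X1], [X2], [X3] the images of
    the generators under [j1], [j2], [j3], the image of [(q (x) 1) q] is
    [j1 * j2 * j3] times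
    [sum_(s, c) L s c * X3 c * (D_s (X1, X2) + (X1 s + X2 s) * L (X1, X2))],
    where [D_s] is lambda shifted by [x_s] ([jacobi_conv]). In the cyclic sum the terms
    without [D_s] cancel, and what remains is the sum of the expressions of condition (3)
    times [X1 i * X2 j * X3 m] ([jacobi_cyclic]). These products are linearly independent
    and the expression is alternating in [i], [j], [m], so that the co-Jacobi identity is
    equivalent to its vanishing for [i < j < m]. *)

Set Implicit Arguments.
Unset Strict Implicit.
Unset Printing Implicit Defensive.

Import GRing.Theory.
Local Open Scope ring_scope.

(** * Pairing two linear maps over a tensor product *)

Section Pairing.
Context (k : comNzRingType) (B : comAlgType k).

(** The linear map [u *t v |-> f u * g v] into a commutative algebra; its formula
    is meaningful for linear [f] and [g]. *)
Definition tpair (U V : lmodType k) (f : U -> B) (g : V -> B) :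
  tensor U V -> B := tlift (fun u v => f u * g v).

Section Linear.
Context (U V : lmodType k) (f : {linear U -> B}) (g : {linear V -> B}).

Fact tpair_bilin : bilin (fun u v => f u * g v).
Proof.
by split=> w c x y; rewrite linearP (mulrDl, mulrDr) -?scalerAl -?scalerAr.
Qed.

Lemma tpair_tens u v : tpair f g (u *t v) = f u * g v.
Proof. exact: (tlift_tens tpair_bilin). Qed.

Fact tpair_linear : linear (tpair f g).
Proof. exact: (tlift_linear tpair_bilin). Qed.

HB.instance Definition _ :=
  GRing.isLinear.Build k (tensor U V) B *:%R (tpair f g) tpair_linear.

Lemma tpairD y z : tpair f g (y + z) = tpair f g y + tpair f g z.
Proof. exact: raddfD. Qed.

Lemma tpairZ c z : tpair f g (c *: z) = c *: tpair f g z.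
Proof. exact: linearZ. Qed.
End Linear.

(** The pairing of two algebra maps is an algebra map. *)
Section Multiplicative.
Context (A : comAlgType k) (f g : {lrmorphism A -> B}).

Fact tpair_monoid_morphism : monoid_morphism (tpair f g).
Proof.
split=> [|x y]; first by rewrite tpair_tens !rmorph1 mulr1.
elim/tensor_ind: x => [u v|x x' Hx Hx']; last first.
  by rewrite mulrDl !tpairD mulrDl Hx Hx'.
elim/tensor_ind: y => [u' v'|y y' Hy Hy']; last first.
  by rewrite mulrDr !tpairD mulrDr Hy Hy'.
by rewrite tensM !tpair_tens !rmorphM mulrACA.
Qed.

HB.instance Definition _ :=
  GRing.isMonoidMorphism.Build (tensor A A) B (tpair f g) tpair_monoid_morphism.
End Multiplicative.
End Pairing.

Section Inclusions.
Context (k : comNzRingType) (A : comAlgType k).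

(** The two canonical algebra maps [a |-> a *t 1] and [a |-> 1 *t a]. *)
Definition tinl (a : A) : tensor A A := a *t 1.
Definition tinr (a : A) : tensor A A := 1 *t a.

Fact tinl_linear : linear tinl.
Proof. by move=> c a b; rewrite /tinl tensDl tensZl. Qed.
Fact tinr_linear : linear tinr.
Proof. by move=> c a b; rewrite /tinr tensDr tensZr. Qed.
Fact tinl_monoid_morphism : monoid_morphism tinl.
Proof. by split=> // a b; rewrite /tinl tensM mulr1. Qed.
Fact tinr_monoid_morphism : monoid_morphism tinr.
Proof. by split=> // a b; rewrite /tinr tensM mulr1. Qed.

HB.instance Definition _ :=
  GRing.isLinear.Build k A (tensor A A) *:%R tinl tinl_linear.
HB.instance Definition _ :=
  GRing.isLinear.Build k A (tensor A A) *:%R tinr tinr_linear.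
HB.instance Definition _ :=
  GRing.isMonoidMorphism.Build A (tensor A A) tinl tinl_monoid_morphism.
HB.instance Definition _ :=
  GRing.isMonoidMorphism.Build A (tensor A A) tinr tinr_monoid_morphism.

Lemma tinl_tinr a b : tinl a * tinr b = a *t b.
Proof. by rewrite /tinl /tinr tensM mulr1 mul1r. Qed.

Lemma tpair_tinl_tinr (z : tensor A A) : tpair tinl tinr z = z.
Proof.
elim/tensor_ind: z => [u v|x y Hx Hy]; first by rewrite tpair_tens tinl_tinr.
by rewrite tpairD Hx Hy.
Qed.
End Inclusions.

(** * Hopf algebras generated by primitive elements *)

(** A commutative Hopf algebra generated by [d] primitive elements. The field
    [ph_ind] says that the generators generate: a linear property of elements
    that holds at [1] and survives multiplication by a generator holds
    everywhere. Of the counit and the antipode only the values that the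
    generators force are recorded; coassociativity, cocommutativity and the
    counit and antipode axioms follow. *)
Structure primhopf (k : fieldType) (d : nat) := PrimHopf {
  ph_alg :> comAlgType k;
  ph_gen : 'I_d -> ph_alg;
  ph_comul : {lrmorphism ph_alg -> tensor ph_alg ph_alg};
  ph_counit : {linear ph_alg -> k^o};
  ph_antipode : {lrmorphism ph_alg -> ph_alg};
  ph_comulX i :
    ph_comul (ph_gen i) = ph_gen i *t 1 + 1 *t ph_gen i;
  ph_counit1 : ph_counit 1 = 1;
  ph_counitX i a : ph_counit (ph_gen i * a) = 0;
  ph_antipodeX i : ph_antipode (ph_gen i) = - ph_gen i;
  ph_ind (P : ph_alg -> Prop) :
    P 1 -> (forall i a, P a -> P (ph_gen i * a)) ->
    (forall c a b, P a -> P b -> P (c *: a + b)) -> forall a, P a }.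

(** * The convolution ring *)

Section Convolution.
Context (k : fieldType) (d : nat) (A : primhopf k d).
Local Notation x := (ph_gen A).
Local Notation Delta := (ph_comul A).

Section ConvolutionRing.
Context (B : comAlgType k).

(** Linear maps from [A] to [B], a type of its own so that [*] denotes the
    convolution product [f * g = (a |-> sum f a_1 * g a_2)]. *)
Record conv := Conv { conv_fun :> A -> B; conv_linear : linear conv_fun }.

HB.instance Definition _ (f : conv) :=
  GRing.isLinear.Build k A B *:%R (conv_fun f) (conv_linear f).

HB.instance Definition _ := gen_eqMixin conv.
HB.instance Definition _ := gen_choiceMixin conv.

Implicit Types f g h : conv.

Lemma convP f g : f =1 g -> f = g.
Proof.
case: f g => [f lf] [g lg] /= /funext efg; subst g.
by rewrite (Prop_irrelevance lf lg).
Qed.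

Definition toconv (f : {linear A -> B}) : conv := Conv (linearP f).

Definition conv0 : conv := toconv \0.
Definition convD f g : conv := toconv (f \+ g).
Definition convN f : conv := toconv (\- f).

Fact convDA : associative convD.
Proof. by move=> f g h; apply: convP => a /=; rewrite addrA. Qed.
Fact convDC : commutative convD.
Proof. by move=> f g; apply: convP => a /=; rewrite addrC. Qed.
Fact conv0D : left_id conv0 convD.
Proof. by move=> f; apply: convP => a /=; rewrite add0r. Qed.
Fact convND : left_inverse conv0 convN convD.
Proof. by move=> f; apply: convP => a /=; rewrite addNr. Qed.

HB.instance Definition _ :=
  GRing.isZmodule.Build conv convDA convDC conv0D convND.

Lemma conv_addE f g a : (f + g) a = f a + g a. Proof. by []. Qed.
Lemma conv_oppE f a : (- f) a = - f a. Proof. by []. Qed.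
Lemma conv_sumE (T : Type) (r : seq T) P (F : T -> conv) a :
  (\sum_(i <- r | P i) F i) a = \sum_(i <- r | P i) F i a.
Proof. exact: (big_morph (fun f : conv => f a)). Qed.

Definition convM f g : conv := toconv (tpair f g \o Delta).

Let convME f g a : convM f g a = tpair f g (Delta a). Proof. by []. Qed.

(** [shift f i] is [a |-> f (x_i * a)]. It is a derivation of the convolution product,
    which reduces the identities below to inductions over [ph_ind]. *)
Fact shift_linear f i : linear (fun a => f (x i * a)).
Proof. by move=> c a b; rewrite mulrDr -scalerAr linearP. Qed.
Definition shift f i : conv := Conv (shift_linear f i).

Let convM1 f g : convM f g 1 = f 1 * g 1.
Proof. by rewrite /= rmorph1 tpair_tens. Qed.

Let convMX f g i a :
  convM f g (x i * a) = convM (shift f i) g a + convM f (shift g i) a.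
Proof.
rewrite !convME; have -> : Delta (x i * a) = (x i *t 1 + 1 *t x i) * Delta a.
  by rewrite rmorphM /= ph_comulX.
elim/tensor_ind: (Delta a) => [u v|y z Hy Hz].
  by rewrite mulrDl !tensM !mul1r tpairD !tpair_tens.
by rewrite mulrDr !tpairD Hy Hz addrACA.
Qed.

Lemma shift_convM f g i : shift (convM f g) i = convM (shift f i) g + convM f (shift g i).
Proof. by apply: convP => a; exact: convMX. Qed.

Fact convMC : commutative convM.
Proof.
move=> f g; apply: convP => a.
elim/ph_ind: a f g => [|i a IHa|c a b IHa IHb] f g.
- by rewrite !convM1 mulrC.
- by rewrite !convMX (IHa (shift f i)) (IHa f) addrC.
by rewrite !conv_linear IHa IHb.
Qed.

Fact convMDl : left_distributive convM +%R.
Proof.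
move=> f g h; apply: convP => a; rewrite conv_addE !convME.
elim/tensor_ind: (Delta a) => [u v|y z Hy Hz].
  by rewrite !tpair_tens -mulrDl.
by rewrite !tpairD Hy Hz addrACA.
Qed.

Fact convMDr : right_distributive convM +%R.
Proof. by move=> f g h; rewrite !(convMC f) convMDl. Qed.

Fact convMA : associative convM.
Proof.
move=> f g h; apply: convP => a.
elim/ph_ind: a f g h => [|i a IHa|c a b IHa IHb] f g h.
- by rewrite !convM1 mulrA.
- by rewrite !convMX !shift_convM convMDl convMDr !conv_addE !IHa addrA.
by rewrite !conv_linear IHa IHb.
Qed.

(** The unit of convolution is the counit followed by the unit of [B]. *)
Fact cunit_linear : linear (fun a => (ph_counit A a : k) *: (1 : B)).
Proof. by move=> c a b; rewrite linearP scalerDl scalerA. Qed.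
Definition cunit : conv := Conv cunit_linear.

Fact conv1M : left_id cunit convM.
Proof.
have c0 f : convM 0 f = 0.
  by apply: (addrI (convM 0 f)); rewrite -convMDl !addr0.
move=> f; apply: convP => a; elim/ph_ind: a f => [|i a IHa|c a b IHa IHb] f.
- by rewrite convM1 /= ph_counit1 scale1r mul1r.
- rewrite convMX IHa; have -> : shift cunit i = 0.
    by apply: convP => b /=; rewrite ph_counitX scale0r.
  by rewrite c0 add0r.
by rewrite !conv_linear IHa IHb.
Qed.

Fact cunit_neq0 : cunit != 0.
Proof.
apply/eqP => /(congr1 (fun f : conv => f 1)) /=.
by rewrite ph_counit1 scale1r; apply/eqP/oner_neq0.
Qed.

HB.instance Definition _ := GRing.Zmodule_isComNzRing.Build conv
  convMA convMC conv1M convMDl cunit_neq0.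
End ConvolutionRing.
End Convolution.

Section ConvolutionTheory.
Context (k : fieldType) (d : nat) (A : primhopf k d).
Local Notation x := (ph_gen A).
Local Notation Delta := (ph_comul A).

Section Basic.
Context (B : comAlgType k).
Implicit Types f g h : conv A B.

Lemma convME f g a : (f * g) a = tpair f g (Delta a). Proof. by []. Qed.

Lemma shiftM f g i : shift (f * g) i = shift f i * g + f * shift g i.
Proof. exact: shift_convM. Qed.

Lemma shift_sum (T : Type) (r : seq T) (F : T -> conv A B) i :
  shift (\sum_(t <- r) F t) i = \sum_(t <- r) shift (F t) i.
Proof. by apply: convP => a; rewrite /= !conv_sumE. Qed.

(** An element of [B] as an element of the convolution ring; convolution with it
    is multiplication by it. *)
Fact cst_linear (b : B) : linear (fun a : A => (ph_counit A a : k) *: b).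
Proof. by move=> c a a'; rewrite linearP scalerDl scalerA. Qed.
Definition cst (b : B) : conv A B := Conv (cst_linear b).

Lemma shift_cst b i : shift (cst b) i = 0.
Proof. by apply: convP => a /=; rewrite ph_counitX scale0r. Qed.

Lemma cstME b f a : (cst b * f) a = b * f a.
Proof.
elim/ph_ind: a f => [|i a IHa|c a a' IHa IHa'] f.
- by rewrite convME rmorph1 tpair_tens /= ph_counit1 scale1r.
- by rewrite -[LHS]/(shift _ _ a) shiftM shift_cst mul0r add0r IHa.
by rewrite !conv_linear IHa IHa' mulrDr scalerAr.
Qed.

Lemma cstM b b' : cst (b * b') = cst b * cst b'.
Proof. by apply: convP => a; rewrite cstME /= scalerAr. Qed.

Lemma cstD b b' : cst (b + b') = cst b + cst b'.
Proof. by apply: convP => a; rewrite /= scalerDr. Qed.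

Lemma shift_alg (j : {lrmorphism A -> B}) i :
  shift (toconv j) i = cst (j (x i)) * toconv j.
Proof. by apply: convP => a; rewrite cstME /= rmorphM. Qed.

(** An algebra map is invertible for convolution, its inverse being its
    composite with the antipode. *)
Lemma toconv_inv (j : {lrmorphism A -> B}) :
  toconv j * toconv (j \o ph_antipode A) = 1.
Proof.
apply: convP => a; elim/ph_ind: a => [|i a IHa|c a b IHa IHb].
- by rewrite convME rmorph1 tpair_tens /= !rmorph1 mulr1 ph_counit1 scale1r.
- rewrite -[LHS]/(shift _ _ a) shiftM shift_alg.
  have -> : shift (toconv (j \o ph_antipode A)) i
            = - (cst (j (x i)) * toconv (j \o ph_antipode A)).
    apply: convP => b; rewrite conv_oppE cstME /=.
    by rewrite !rmorphM /= ph_antipodeX rmorphN mulNr.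
  by rewrite mulrN mulrCA mulrA subrr /= ph_counitX scale0r.
by rewrite !conv_linear IHa IHb.
Qed.

Lemma toconv_inj (j : {lrmorphism A -> B}) f g :
  f * toconv j = g * toconv j -> f = g.
Proof.
move=> /(congr1 (fun u => u * toconv (j \o ph_antipode A))).
by rewrite -!mulrA toconv_inv !mulr1.
Qed.
End Basic.

Section PostComposition.
Context (B B' : comAlgType k).
(** Composition with a linear map [h] on the left: additive in general, and
    multiplicative when [h] is an algebra map ([cpostM]). *)
Definition cpost (h : {linear B -> B'}) (f : conv A B) : conv A B' :=
  toconv (h \o f).

Lemma cpostE h f a : cpost h f a = h (f a). Proof. by []. Qed.

Lemma shift_cpost h f i : shift (cpost h f) i = cpost h (shift f i).
Proof. exact: convP. Qed.

Lemma cpostD h f g : cpost h (f + g) = cpost h f + cpost h g.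
Proof. by apply: convP => a /=; rewrite raddfD. Qed.

Lemma cpost_sum h (T : Type) (r : seq T) (F : T -> conv A B) :
  cpost h (\sum_(t <- r) F t) = \sum_(t <- r) cpost h (F t).
Proof. by apply: convP => a; rewrite /= !conv_sumE /= raddf_sum. Qed.

Lemma cpostM (h : {lrmorphism B -> B'}) f g :
  cpost h (f * g) = cpost h f * cpost h g.
Proof.
apply: convP => a; elim/ph_ind: a f g => [|i a IHa|c a b IHa IHb] f g.
- by rewrite cpostE !convME rmorph1 !tpair_tens /= rmorphM.
- rewrite -[LHS]/(shift _ _ a) -[RHS]/(shift _ _ a) shiftM !shift_cpost.
  by rewrite shiftM cpostD !conv_addE !IHa.
by rewrite !conv_linear IHa IHb.
Qed.
End PostComposition.

Section Scalars.
Context (B : comAlgType k).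
(** A linear form on [A], as an element of the convolution ring of [B]. *)
Fact csc_linear (L : conv A k^o) : linear (fun a => (L a : k) *: (1 : B)).
Proof. by move=> c a b; rewrite conv_linear scalerDl scalerA. Qed.
Definition csc (L : conv A k^o) : conv A B := Conv (csc_linear L).

Lemma csc1E L a : csc L a = (L a : k) *: 1. Proof. by []. Qed.

Lemma shift_csc L i : shift (csc L) i = csc (shift L i).
Proof. exact: convP. Qed.

Lemma cscD L L' : csc (L + L') = csc L + csc L'.
Proof. by apply: convP => a /=; rewrite scalerDl. Qed.

Lemma cscM L L' : csc (L * L') = csc L * csc L'.
Proof.
apply: convP => a; elim/ph_ind: a L L' => [|i a IHa|c a b IHa IHb] L L'.
- by rewrite csc1E !convME rmorph1 !tpair_tens /= -scalerAl mul1r scalerA.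
- rewrite -[LHS]/(shift _ _ a) -[RHS]/(shift _ _ a) shiftM !shift_csc.
  by rewrite shiftM cscD !conv_addE !IHa.
by rewrite !conv_linear IHa IHb.
Qed.

Lemma cscE L (b : B) a : (csc L * cst b) a = (L a : k) *: b.
Proof. by rewrite mulrC cstME /= -scalerAr mulr1. Qed.
End Scalars.

(** Composition with a linear map commutes with convolution by linear forms. *)
Lemma cpost_csc (B B' : comAlgType k) (h : {linear B -> B'}) L f :
  cpost h (csc B L * f) = csc B' L * cpost h f.
Proof.
apply: convP => a; elim/ph_ind: a L f => [|i a IHa|c a b IHa IHb] L f.
- by rewrite cpostE !convME rmorph1 !tpair_tens /= -!scalerAl !mul1r linearZ.
- rewrite -[LHS]/(shift _ _ a) -[RHS]/(shift _ _ a) shiftM !shift_cpost.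
  by rewrite shiftM !shift_csc cpostD !conv_addE !IHa.
by rewrite !conv_linear IHa IHb.
Qed.

Lemma cpost_tpair (B : comAlgType k) (f g : conv A B) i j :
  cpost (tpair f g) (cst (x i *t x j) * toconv Delta) = shift f i * shift g j.
Proof.
apply: convP => a; rewrite cpostE cstME convME [LHS]/=.
elim/tensor_ind: (Delta a) => [u v|y z Hy Hz]; first by rewrite tensM !tpair_tens.
by rewrite mulrDr !tpairD Hy Hz.
Qed.
End ConvolutionTheory.

(** * The cyclic identity behind the Jacobi condition *)

Section CyclicIdentity.
Context (R : comNzRingType) (d : nat).
Implicit Types (L : 'I_d -> 'I_d -> R) (D : 'I_d -> 'I_d -> 'I_d -> R).
Implicit Types (u v w : 'I_d -> R).

(** The bilinear form with matrix [L]. *)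
Definition bform L u v : R := \sum_i \sum_j L i j * (u i * v j).

(** One of the three cyclic terms of the co-Jacobi identity, in a commutative
    ring where [L] stands for lambda and [D s] for lambda shifted by the generator
    of index [s]. *)
Definition jacobi_term L D u v w : R :=
  \sum_s \sum_c L s c * (w c * (bform (D s) u v + (u s + v s) * bform L u v)).

(** The expression in condition (3), with [L] and [D] as in [jacobi_term]. *)
Definition jacobi_coef L D i j m : R :=
  \sum_s (L s m * D s i j + L s i * D s j m + L s j * D s m i).

Lemma bform_skew L u v :
  (forall i j, L j i = - L i j) -> bform L v u = - bform L u v.
Proof.
move=> skL; rewrite /bform exchange_big -sumrN; apply: eq_bigr => i _.
by rewrite -sumrN; apply: eq_bigr => j _; rewrite skL mulNr [v j * _]mulrC.
Qed.

Lemma jacobi_termE L D u v w : jacobi_term L D u v w =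
  \sum_i \sum_j \sum_m (\sum_s L s m * D s i j) * (u i * v j * w m)
  + (bform L u w + bform L v w) * bform L u v.
Proof.
have -> : \sum_i \sum_j \sum_m (\sum_s L s m * D s i j) * (u i * v j * w m)
          = \sum_s \sum_m L s m * (w m * bform (D s) u v).
  transitivity (\sum_i \sum_j \sum_s \sum_m L s m * D s i j * (u i * v j * w m)).
    apply: eq_bigr => i _; apply: eq_bigr => j _; rewrite exchange_big.
    by apply: eq_bigr => m _; rewrite mulr_suml.
  transitivity (\sum_i \sum_s \sum_m \sum_j L s m * D s i j * (u i * v j * w m)).
    apply: eq_bigr => i _; rewrite exchange_big; apply: eq_bigr => s _.
    exact: exchange_big.
  rewrite exchange_big; apply: eq_bigr => s _; rewrite exchange_big.
  apply: eq_bigr => m _; rewrite [RHS]mulrA mulr_sumr; apply: eq_bigr => i _.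
  by rewrite mulr_sumr; apply: eq_bigr => j _; ring.
rewrite [bform L u w]/bform [bform L v w]/bform -big_split mulr_suml.
rewrite -big_split /=; apply: eq_bigr => s _.
rewrite -big_split mulr_suml -big_split /=; apply: eq_bigr => m _.
ring.
Qed.

(** The terms without [D] cancel: if [p], [r], [t] are the values of the skew form
    on [(u, v)], [(v, w)], [(w, u)], they are [(r - t) * p], [(t - p) * r] and
    [(p - r) * t]. *)
Lemma jacobi_cyclic L D u v w : (forall i j, L j i = - L i j) ->
  jacobi_term L D u v w + jacobi_term L D v w u + jacobi_term L D w u v
  = \sum_i \sum_j \sum_m jacobi_coef L D i j m * (u i * v j * w m).
Proof.
move=> skL; pose T i j m := \sum_s L s m * D s i j.
pose S u v w := \sum_i \sum_j \sum_m T i j m * (u i * v j * w m).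
have S1 : S v w u = \sum_i \sum_j \sum_m T j m i * (u i * v j * w m).
  rewrite [RHS]exchange_big; apply: eq_bigr => j _.
  rewrite [RHS]exchange_big; apply: eq_bigr => m _; apply: eq_bigr => i _.
  by congr (_ * _); ring.
have S2 : S w u v = \sum_i \sum_j \sum_m T m i j * (u i * v j * w m).
  transitivity (\sum_i \sum_m \sum_j T m i j * (u i * v j * w m)); last first.
    by apply: eq_bigr => i _; exact: exchange_big.
  rewrite [RHS]exchange_big; apply: eq_bigr => m _; apply: eq_bigr => i _.
  by apply: eq_bigr => j _; congr (_ * _); ring.
rewrite !jacobi_termE -!/(S _ _ _) S1 S2.
rewrite (bform_skew v u) // (bform_skew w v) // (bform_skew u w) //.
transitivity (S u v w + \sum_i \sum_j \sum_m T j m i * (u i * v j * w m)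
              + \sum_i \sum_j \sum_m T m i j * (u i * v j * w m)).
  by rewrite /S; ring.
rewrite -!big_split; apply: eq_bigr => i _ /=.
rewrite -!big_split; apply: eq_bigr => j _ /=.
rewrite -!big_split; apply: eq_bigr => m _ /=.
by rewrite -!mulrDl /jacobi_coef !big_split.
Qed.
End CyclicIdentity.

(** * Pairings of a map of the form I * Delta *)

Section JacobiTerm.
Context (k : fieldType) (d : nat) (A : primhopf k d).
Local Notation x := (ph_gen A).
Local Notation Delta := (ph_comul A).
Local Notation T := (tensor A A).
Context (L : 'I_d -> 'I_d -> conv A k^o) (I : conv A T) (q : {linear A -> T}).
Hypothesis IE : forall a, I a = \sum_i \sum_j (L i j a : k) *: (x i *t x j).
Hypothesis qE : toconv q = I * toconv Delta.
Context (B : comAlgType k).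

Let cL i j := csc B (L i j).

Lemma I_cscE : I = \sum_i \sum_j csc T (L i j) * cst A (x i *t x j).
Proof.
apply: convP => a; rewrite IE conv_sumE; apply: eq_bigr => i _.
by rewrite conv_sumE; apply: eq_bigr => j _; rewrite cscE.
Qed.

(** The images of the generators under [j], as elements of the convolution ring. *)
Definition cgen (j : {linear A -> B}) i : conv A B := cst A (j (x i)).

Lemma cpost_IE (f g : {linear A -> B}) :
  cpost (tpair f g) I = bform cL (cgen f) (cgen g).
Proof.
rewrite I_cscE cpost_sum; apply: eq_bigr => i _.
rewrite cpost_sum; apply: eq_bigr => j _; rewrite cpost_csc -cstM.
by congr (_ * _); apply: convP => a; rewrite cpostE /= linearZ /= tpair_tens.
Qed.

Lemma shift_cpost_IE (f g : {linear A -> B}) s :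
  shift (cpost (tpair f g) I) s
  = bform (fun i j => csc B (shift (L i j) s)) (cgen f) (cgen g).
Proof.
rewrite cpost_IE /bform shift_sum; apply: eq_bigr => i _.
rewrite shift_sum; apply: eq_bigr => j _.
by rewrite -cstM shiftM shift_cst mulr0 addr0 shift_csc.
Qed.

Context (j1 j2 j3 : {lrmorphism A -> B}).

Lemma cpost_DeltaE : cpost (tpair j1 j2) (toconv Delta) = toconv j1 * toconv j2.
Proof. exact: convP. Qed.

Lemma cpost_qE : cpost (tpair j1 j2) (toconv q)
  = bform cL (cgen j1) (cgen j2) * (toconv j1 * toconv j2).
Proof. by rewrite qE cpostM cpost_DeltaE cpost_IE. Qed.

(** The image of [(q (x) 1) q] under the algebra map with components [j1], [j2], [j3]. *)
Lemma jacobi_conv :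
  toconv (tpair (tpair j1 j2 \o q) j3 \o q)
  = jacobi_term cL (fun s i j => csc B (shift (L i j) s))
      (cgen j1) (cgen j2) (cgen j3) * (toconv j1 * toconv j2 * toconv j3).
Proof.
pose f := cpost (tpair j1 j2) (toconv q).
transitivity (cpost (tpair f (toconv j3)) (toconv q)).
  by apply: convP.
rewrite qE I_cscE mulr_suml cpost_sum mulr_suml; apply: eq_bigr => s _.
rewrite mulr_suml cpost_sum mulr_suml; apply: eq_bigr => c _.
rewrite -mulrA cpost_csc cpost_tpair shift_alg /f cpost_qE shiftM.
have shE := shift_cpost_IE j1 j2 s; rewrite cpost_IE in shE.
rewrite shE shiftM !shift_alg /cgen /cL.
ring.
Qed.
End JacobiTerm.

(** * The co-Poisson axioms in terms of pairings *)

Section PairingMaps.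
Context (k : comNzRingType).

Fact tmap_linear (U V U' V' : lmodType k) (f : {linear U -> U'})
  (g : {linear V -> V'}) : linear (tmap f g).
Proof.
apply: tlift_linear.
by split=> [w|w] c x y; rewrite linearP ?(bilin_tens _ _).1 ?(bilin_tens _ _).2.
Qed.

Fact t3_linear (V : lmodType k) : linear (@t3 k V).
Proof.
have b x : bilin (fun v1 v2 : V => ((x : V) *t v1) *t v2).
  by split=> z c y y'; rewrite ?(tensDl, tensZl, tensDr, tensZr).
apply: tlift_linear; split=> [x|y c u1 u2]; first exact: tlift_linear.
by apply: tlift_funP => // v' w'; rewrite !(tensDl, tensZl).
Qed.

Fact tassoc_linear (U V W : lmodType k) : linear (@tassoc k U V W).
Proof.
have b x : bilin (fun (v : V) (w : W) => (x : U) *t v *t w).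
  by split=> z c y y'; rewrite ?(tensDl, tensZl, tensDr, tensZr).
apply: tlift_linear; split=> [y c u1 u2|x]; last exact: tlift_linear.
by apply: tlift_funP => // v' w'; rewrite !(tensDl, tensZl).
Qed.

Fact t2_linear (V : lmodType k) : linear (@t2 k V).
Proof.
apply: tlift_linear.
by split=> z c y y'; rewrite ?(tensDl, tensZl, tensDr, tensZr).
Qed.

HB.instance Definition _ (U V U' V' : lmodType k) (f : {linear U -> U'})
    (g : {linear V -> V'}) :=
  GRing.isLinear.Build k _ _ *:%R (tmap f g) (tmap_linear f g).
HB.instance Definition _ (V : lmodType k) :=
  GRing.isLinear.Build k _ _ *:%R (@t3 k V) (@t3_linear V).
HB.instance Definition _ (V : lmodType k) :=
  GRing.isLinear.Build k _ _ *:%R (@t2 k V) (@t2_linear V).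
HB.instance Definition _ (U V W : lmodType k) :=
  GRing.isLinear.Build k _ _ *:%R (@tassoc k U V W) (@tassoc_linear U V W).

Context (B : comAlgType k).

Lemma tpair_tmap (U V U' V' : lmodType k) (p : {linear U -> U'})
    (r : {linear V -> V'}) (f : {linear U' -> B}) (g : {linear V' -> B}) z :
  tpair f g (tmap p r z) = tpair (f \o p) (g \o r) z.
Proof.
elim/tensor_ind: z => [u v|y z Hy Hz].
  by rewrite tmap_tens !tpair_tens.
by rewrite (raddfD (tmap p r)) !tpairD Hy Hz.
Qed.

Lemma tpair_t2 (V : lmodType k) (f g : {linear V -> B}) z :
  tpair f g (t2 z) = tpair g f z.
Proof.
elim/tensor_ind: z => [u v|y z Hy Hz]; first by rewrite t2_tens !tpair_tens mulrC.
by rewrite raddfD !tpairD Hy Hz.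
Qed.

Lemma tpair_t3 (V : lmodType k) (f g h : {linear V -> B}) z :
  tpair (tpair f g) h (t3 z) = tpair (tpair g h) f z.
Proof.
elim/tensor_ind: z => [u w|y z Hy Hz]; last by rewrite raddfD !tpairD Hy Hz.
elim/tensor_ind: u => [u v|y z Hy Hz].
  by rewrite t3_tens !tpair_tens /= !tpair_tens -mulrA mulrC.
by rewrite tensDl raddfD !tpairD Hy Hz.
Qed.

Lemma tpair_tassoc (U V W : lmodType k) (f : {linear U -> B})
    (g : {linear V -> B}) (h : {linear W -> B}) z :
  tpair (tpair f g) h (tassoc z) = tpair f (tpair g h) z.
Proof.
elim/tensor_ind: z => [u w|y z Hy Hz]; last by rewrite raddfD !tpairD Hy Hz.
elim/tensor_ind: w => [v w|y z Hy Hz].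
  by rewrite tassoc_tens !tpair_tens /= !tpair_tens mulrA.
by rewrite tensDr raddfD !tpairD Hy Hz.
Qed.
End PairingMaps.

Section TripleTensor.
Context (k : comNzRingType) (A : comAlgType k).
Local Notation T := (tensor A A).

Local Notation emb1 := (@tinl k T \o @tinl k A).
Local Notation emb2 := (@tinl k T \o @tinr k A).
Local Notation emb3 := (@tinr k T \o @tinl k A).

(** Three algebra maps into a common algebra that separate the points of the third
    tensor power of [A]: take [B = (A (x) A) (x) (A (x) A)] and send
    [(u *t v) *t w] to [(u *t v) *t (w *t 1)]. *)
Lemma tpair3_inj : exists (B : comAlgType k) (j1 j2 j3 : {lrmorphism A -> B}),
  injective (tpair (tpair j1 j2) j3).
Proof.
exists (tensor T T), emb1, emb2, emb3.
have embE z : tpair (tpair emb1 emb2) emb3 z = tmap idfun (@tinl k A) z.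
  elim/tensor_ind: z => [u w|y z Hy Hz]; last by rewrite tpairD raddfD Hy Hz.
  elim/tensor_ind: u => [u v|y z Hy Hz]; last by rewrite tensDl tpairD raddfD Hy Hz.
  rewrite !tpair_tens tmap_tens /= !tpair_tens /=.
  by rewrite -(rmorphM (@tinl k T)) /= tinl_tinr tinl_tinr.
(* Multiplication of the last two factors is a left inverse. *)
apply: (can_inj (g := tmap idfun (tpair idfun idfun))) => z; rewrite embE.
elim/tensor_ind: z => [u v|y z Hy Hz].
  by rewrite !tmap_tens /= /tinl tpair_tens mulr1.
by rewrite (raddfD (tmap _ _)) (raddfD (tmap _ _)) -[in RHS]Hy -[in RHS]Hz.
Qed.
End TripleTensor.

Section CoPoissonPairing.
Context (k : fieldType) (d : nat) (A : primhopf k d).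
Local Notation x := (ph_gen A).
Local Notation Delta := (ph_comul A).
Local Notation T := (tensor A A).
Context (q : {linear A -> T}).

(** The co-Jacobi and co-Leibniz identities after evaluation at three algebra maps.
    The rotation [t3] has become a rotation of the three maps, so that no algebra
    structure on the third tensor power of [A] is needed. *)
Definition cojacobi_pairing (B : comAlgType k) (j1 j2 j3 : {lrmorphism A -> B}) :=
  toconv (tpair (tpair j1 j2 \o q) j3 \o q)
  + toconv (tpair (tpair j2 j3 \o q) j1 \o q)
  + toconv (tpair (tpair j3 j1 \o q) j2 \o q) = 0 :> conv A B.

Definition coleibniz_pairing (B : comAlgType k) (j1 j2 j3 : {lrmorphism A -> B}) :=
  cpost (tpair (tpair j1 j2 \o Delta) j3) (toconv q)
  = toconv j1 * cpost (tpair j2 j3) (toconv q)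
    - cpost (tpair j3 j1) (toconv q) * toconv j2 :> conv A B.

Lemma co_poissonP : co_poisson Delta q <->
  [/\ forall a, q a + t2 (q a) = 0,
      forall (B : comAlgType k) (j1 j2 j3 : {lrmorphism A -> B}),
        cojacobi_pairing j1 j2 j3
    & forall (B : comAlgType k) (j1 j2 j3 : {lrmorphism A -> B}),
        coleibniz_pairing j1 j2 j3].
Proof.
have jac (B : comAlgType k) (j1 j2 j3 : {lrmorphism A -> B}) a :
    let w := tmap q idfun (q a) in
    tpair (tpair j1 j2) j3 (w + t3 w + t3 (t3 w))
    = (toconv (tpair (tpair j1 j2 \o q) j3 \o q)
       + toconv (tpair (tpair j2 j3 \o q) j1 \o q)
       + toconv (tpair (tpair j3 j1 \o q) j2 \o q)) a.
  by move=> w; rewrite !tpairD !tpair_t3 !tpair_tmap.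
have leib (B : comAlgType k) (j1 j2 j3 : {lrmorphism A -> B}) a :
    tpair (tpair j1 j2) j3 (tassoc (tmap idfun q (Delta a))
      - t3 (t3 (tmap q idfun (Delta a))))
    = (toconv j1 * cpost (tpair j2 j3) (toconv q)
      - cpost (tpair j3 j1) (toconv q) * toconv j2) a.
  by rewrite raddfB /= !tpair_t3 tpair_tassoc !tpair_tmap.
split=> [[skq jq lq]|[skq jq lq]]; split=> //.
- by move=> B j1 j2 j3; apply: convP => a; rewrite -jac jq raddf0.
- by move=> B j1 j2 j3; apply: convP => a; rewrite -leib -lq tpair_tmap.
- have [B [j1 [j2 [j3 injE]]]] := tpair3_inj A.
  by move=> a; apply: injE; rewrite jac jq raddf0.
have [B [j1 [j2 [j3 injE]]]] := tpair3_inj A.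
by move=> a; apply: injE; rewrite leib -lq tpair_tmap.
Qed.
End CoPoissonPairing.

(** * Sufficiency of the conditions *)

Section JacobiCoef.
Context (R : comNzRingType) (d : nat).
Context (L : 'I_d -> 'I_d -> R) (D : 'I_d -> 'I_d -> 'I_d -> R).
Hypotheses (skL : forall i j, L j i = - L i j)
  (skD : forall s i j, D s j i = - D s i j).

Lemma jacobi_coef_rot i j m : jacobi_coef L D j m i = jacobi_coef L D i j m.
Proof. by apply: eq_bigr => s _; ring. Qed.

Lemma jacobi_coef_swap i j m : jacobi_coef L D j i m = - jacobi_coef L D i j m.
Proof.
rewrite /jacobi_coef -sumrN; apply: eq_bigr => s _.
by rewrite (skD _ i j) (skD _ m i) (skD _ j m); ring.
Qed.

(** [jacobi_coef] is alternating, so that increasing triples of indices decide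
    whether it vanishes. The hypothesis on [r] replaces invertibility of [2]. *)
Lemma jacobi_coef_eq0 : (forall r : R, r = - r -> r = 0) ->
  (forall i j m : 'I_d, (i < j)%N -> (j < m)%N -> jacobi_coef L D i j m = 0) ->
  forall i j m, jacobi_coef L D i j m = 0.
Proof.
move=> two C0.
have Cii i m : jacobi_coef L D i i m = 0 by apply: two; rewrite -jacobi_coef_swap.
have rotE := jacobi_coef_rot; have swapE := jacobi_coef_swap.
have Clt (i j m : 'I_d) : (i < j)%N -> jacobi_coef L D i j m = 0.
  move=> ltij; case: (ltngtP j m) => [ltjm|ltmj|/val_inj <-].
  - exact: C0.
  - case: (ltngtP m i) => [ltmi|ltim|/val_inj ->].
    + by rewrite rotE C0.
    + by rewrite -rotE swapE rotE C0 ?oppr0.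
    + by rewrite rotE Cii.
  by rewrite -rotE Cii.
move=> i j m; case: (ltngtP i j) => [/Clt->//|/Clt ltji|/val_inj->//].
by rewrite swapE ltji oppr0.
Qed.
End JacobiCoef.

Section Sufficiency.
Context (k : fieldType) (d : nat) (A : primhopf k d).
Local Notation x := (ph_gen A).
Local Notation Delta := (ph_comul A).
Local Notation T := (tensor A A).
Context (L : 'I_d -> 'I_d -> conv A k^o) (I : conv A T) (q : {linear A -> T}).
Hypothesis IE : forall a, I a = \sum_i \sum_j (L i j a : k) *: (x i *t x j).
Hypothesis qE : toconv q = I * toconv Delta.
Hypothesis skL : forall i j, L j i = - L i j.

Lemma csc_skew (B : comAlgType k) i j : csc B (L j i) = - csc B (L i j).
Proof. by apply: convP => a /=; rewrite skL /= scaleNr. Qed.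

Lemma skew_q a : q a + t2 (q a) = 0.
Proof.
rewrite -[q a in X in X + _]tpair_tinl_tinr -[t2 _]tpair_tinl_tinr tpair_t2.
rewrite -[LHS]/((cpost (tpair (@tinl k A) (@tinr k A)) (toconv q)
  + cpost (tpair (@tinr k A) (@tinl k A)) (toconv q)) a).
rewrite !(cpost_qE IE qE) [in X in _ + X](bform_skew _ _ (csc_skew _)).
by rewrite mulNr [toconv _ * toconv (@tinl k A)]mulrC subrr.
Qed.

Context (B : comAlgType k) (j1 j2 j3 : {lrmorphism A -> B}).

Lemma coleibniz_q : coleibniz_pairing q j1 j2 j3.
Proof.
pose j12 : {lrmorphism A -> B} := tpair j1 j2 \o Delta.
have j12E : toconv j12 = toconv j1 * toconv j2 by exact: convP.
have cgE i : cgen j12 i = cgen j1 i + cgen j2 i.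
  rewrite -cstD; congr cst; rewrite /= ph_comulX tpairD !tpair_tens.
  by rewrite !rmorph1 mul1r mulr1.
rewrite /coleibniz_pairing -/j12 !(cpost_qE IE qE) j12E.
rewrite (bform_skew (cgen j1) (cgen j3) (csc_skew _)).
have -> : bform (fun i j => csc B (L i j)) (cgen j12) (cgen j3)
   = bform (fun i j => csc B (L i j)) (cgen j1) (cgen j3)
     + bform (fun i j => csc B (L i j)) (cgen j2) (cgen j3).
  rewrite -big_split; apply: eq_bigr => i _ /=; rewrite -big_split.
  by apply: eq_bigr => j _ /=; rewrite cgE; ring.
ring.
Qed.

Lemma csc_jacobi i j m :
  jacobi_coef (fun i j => csc B (L i j)) (fun s i j => csc B (shift (L i j) s)) i j m
  = csc B (jacobi_coef L (fun s i j => shift (L i j) s) i j m).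
Proof.
apply: convP => a.
rewrite csc1E !conv_sumE scaler_suml; apply: eq_bigr => s _.
by rewrite -!cscM -!cscD.
Qed.

(** The cyclic sum is that of condition (3), up to an invertible factor. *)
Lemma cojacobiE :
  toconv (tpair (tpair j1 j2 \o q) j3 \o q)
  + toconv (tpair (tpair j2 j3 \o q) j1 \o q)
  + toconv (tpair (tpair j3 j1 \o q) j2 \o q)
  = (\sum_i \sum_j \sum_m
       csc B (jacobi_coef L (fun s i j => shift (L i j) s) i j m)
       * (cgen j1 i * cgen j2 j * cgen j3 m))
    * (toconv j1 * toconv j2 * toconv j3).
Proof.
rewrite !(jacobi_conv IE qE).
have -> : \sum_i \sum_j \sum_m
       csc B (jacobi_coef L (fun s i j => shift (L i j) s) i j m)
       * (cgen j1 i * cgen j2 j * cgen j3 m)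
  = \sum_i \sum_j \sum_m
       jacobi_coef (fun i j => csc B (L i j)) (fun s i j => csc B (shift (L i j) s))
         i j m * (cgen j1 i * cgen j2 j * cgen j3 m).
  apply: eq_bigr => i _; apply: eq_bigr => j _; apply: eq_bigr => m _.
  by rewrite csc_jacobi.
rewrite -(jacobi_cyclic _ _ _ _ (csc_skew B)) !mulrDl.
by congr (_ + _ * _ + _ * _); ring.
Qed.
End Sufficiency.

(** * Necessity of the conditions *)

Section Necessity.
Context (k : fieldType) (d : nat) (A : primhopf k d).
Local Notation x := (ph_gen A).
Local Notation Delta := (ph_comul A).
Local Notation T := (tensor A A).
Local Notation tl := (@tinl k A).
Local Notation tr := (@tinr k A).
Context (c : 'I_d -> {linear A -> k^o}).
Hypothesis c_gen : forall i j, c i (x j) = (i == j)%:R.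

Section JacobiNecessity.
Context (L : 'I_d -> 'I_d -> conv A k^o) (I : conv A T) (q : {linear A -> T}).
Hypothesis IE : forall a, I a = \sum_i \sum_j (L i j a : k) *: (x i *t x j).
Hypothesis qE : toconv q = I * toconv Delta.
Hypothesis skL : forall i j, L j i = - L i j.

(** The co-Jacobi identity implies condition (3), because the products of three
    generators are linearly independent, as the forms [c] show. *)
Lemma cojacobi_coef_eq0 :
  (forall (B : comAlgType k) (j1 j2 j3 : {lrmorphism A -> B}),
     cojacobi_pairing q j1 j2 j3) ->
  forall i j m, jacobi_coef L (fun s i j => shift (L i j) s) i j m = 0.
Proof.
set C := jacobi_coef _ _; move=> jq i j m; apply: convP => a.
have [B [j1 [j2 [j3 injE]]]] := tpair3_inj A.
have := jq B j1 j2 j3; rewrite /cojacobi_pairing (cojacobiE IE qE skL) -/C.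
rewrite -[X in _ = X](mul0r (toconv j1 * toconv j2 * toconv j3)) !mulrA.
move=> /toconv_inj/toconv_inj/toconv_inj C0.
pose z := \sum_i \sum_j \sum_m (C i j m a : k) *: ((x i *t x j) *t x m).
have Ez : (\sum_i \sum_j \sum_m csc B (C i j m) * (cgen j1 i * cgen j2 j * cgen j3 m)) a
         = tpair (tpair j1 j2) j3 z.
  rewrite conv_sumE raddf_sum; apply: eq_bigr => i1 _.
  rewrite conv_sumE raddf_sum; apply: eq_bigr => i2 _.
  rewrite conv_sumE raddf_sum; apply: eq_bigr => i3 _.
  by rewrite [RHS]/= tpairZ !tpair_tens [X in _ = _ *: (X * _)]/= tpair_tens -!cstM cscE.
have : z = 0 by apply: injE; rewrite -Ez C0 raddf0.
move=> z0; transitivity (tpair (tpair (c i) (c j)) (c m) z); last by rewrite z0 raddf0.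
rewrite raddf_sum (bigD1 i) //= [X in _ = _ + X]big1 ?addr0; last first.
  move=> i' /negPf ne; rewrite raddf_sum big1 // => j' _.
  rewrite raddf_sum big1 // => m' _.
  by rewrite /= tpairZ /= !tpair_tens /= !tpair_tens c_gen eq_sym ne !mul0r scaler0.
rewrite raddf_sum (bigD1 j) //= [X in _ = _ + X]big1 ?addr0; last first.
  move=> j' /negPf ne; rewrite raddf_sum big1 // => m' _.
  by rewrite /= tpairZ /= !tpair_tens /= !tpair_tens !c_gen [_ == j']eq_sym ne
    mulr0 mul0r scaler0.
rewrite raddf_sum (bigD1 m) //= [X in _ = _ + X]big1 ?addr0; last first.
  move=> m' /negPf ne.
  by rewrite /= tpairZ /= !tpair_tens /= !tpair_tens !c_gen [_ == m']eq_sym ne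
    mulr0 scaler0.
rewrite /= tpairZ /= !tpair_tens /= !tpair_tens !c_gen !eqxx !mulr1.
by rewrite /GRing.scale /= mulr1.
Qed.
End JacobiNecessity.

(** The second premise says that [t] doubles when [mult o Delta] is applied to its
    first factor. *)
Hypothesis prim_decomp : forall t : T, t + t2 t = 0 ->
  tpair (tpair tl tl \o Delta) tr t = t + t ->
  t = \sum_i \sum_j (tpair (c i) (c j) t : k) *: (x i *t x j).

Context (q : {linear A -> T}).
Hypothesis skq : forall a, q a + t2 (q a) = 0.
Hypothesis leibq : forall (B : comAlgType k) (j1 j2 j3 : {lrmorphism A -> B}),
  coleibniz_pairing q j1 j2 j3.

(** The map [I] of the theorem: [q] convolved with the inverse of [Delta]. *)
Definition deconv : conv A T := toconv q * toconv (Delta \o ph_antipode A).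

Lemma deconvK : toconv q = deconv * toconv Delta.
Proof. by rewrite /deconv -mulrA [_ * toconv Delta]mulrC toconv_inv mulr1. Qed.

Lemma toconv_Delta : toconv Delta = toconv tl * toconv tr.
Proof. by apply: convP => a; apply: esym (tpair_tinl_tinr _). Qed.

Lemma cpost_tinl_tinr (f : conv A T) : cpost (tpair tl tr) f = f.
Proof. by apply: convP => a; rewrite cpostE /= tpair_tinl_tinr. Qed.

Lemma cpost_t2 (f : conv A T) a : cpost (tpair tr tl) f a = t2 (f a).
Proof. by rewrite cpostE /= -tpair_t2 tpair_tinl_tinr. Qed.

Lemma t2_q : cpost (tpair tr tl) (toconv q) = - toconv q.
Proof.
apply: convP => a; rewrite cpost_t2 conv_oppE.
by apply/eqP; rewrite -addr_eq0 addrC; apply/eqP/skq.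
Qed.

Lemma deconv_skew a : deconv a + t2 (deconv a) = 0.
Proof.
have: cpost (tpair tr tl) deconv = - deconv.
  have DE : cpost (tpair tr tl) (toconv Delta) = toconv Delta.
    by rewrite (cpost_DeltaE tr tl) mulrC toconv_Delta.
  apply: (@toconv_inj _ _ _ _ Delta).
  by rewrite mulNr -deconvK -t2_q -[in LHS]DE -cpostM -deconvK.
by move=> e; rewrite -cpost_t2 e conv_oppE subrr.
Qed.

(** The co-Leibniz identity for [q] says, together with skew-symmetry, that [deconv]
    is primitive in its first argument; only the case [j1 = j2] is used below. *)
Lemma deconv_coleibniz (B : comAlgType k) (j1 j2 j3 : {lrmorphism A -> B}) :
  cpost (tpair (tpair j1 j2 \o Delta) j3) deconv
  = cpost (tpair j2 j3) deconv - cpost (tpair j3 j1) deconv.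
Proof.
pose j12 : {lrmorphism A -> B} := tpair j1 j2 \o Delta.
have j12E : toconv j12 = toconv j1 * toconv j2 by exact: convP.
have qE (f g : {lrmorphism A -> B}) : cpost (tpair f g) (toconv q)
    = cpost (tpair f g) deconv * (toconv f * toconv g).
  by rewrite deconvK cpostM cpost_DeltaE.
have := leibq j1 j2 j3; rewrite /coleibniz_pairing -/j12 !qE j12E => e.
apply: (@toconv_inj _ _ _ _ j1); apply: (@toconv_inj _ _ _ _ j2).
apply: (@toconv_inj _ _ _ _ j3); rewrite -!mulrA [_ * (toconv j2 * _)]mulrA.
rewrite [LHS]e; ring.
Qed.

Lemma deconv_prim a :
  tpair (tpair tl tl \o Delta) tr (deconv a) = deconv a + deconv a.
Proof.
have /(congr1 (fun f : conv A T => f a)) := deconv_coleibniz tl tl tr.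
rewrite conv_addE conv_oppE cpost_t2 cpost_tinl_tinr.
have -> : t2 (deconv a) = - deconv a.
  by apply/eqP; rewrite -addr_eq0 addrC deconv_skew.
by rewrite opprK.
Qed.

Definition deconv_coef i j : conv A k^o := cpost (tpair (c i) (c j)) deconv.

Lemma deconvE a : deconv a
  = \sum_i \sum_j (deconv_coef i j a : k) *: (x i *t x j).
Proof. exact: prim_decomp (deconv_skew a) (deconv_prim a). Qed.

Lemma deconv_coef_skew i j : deconv_coef j i = - deconv_coef i j.
Proof.
apply: convP => a; apply/eqP; rewrite conv_oppE -addr_eq0 addrC; apply/eqP.
have := congr1 (tpair (c i) (c j)) (deconv_skew a).
by rewrite tpairD tpair_t2 raddf0.
Qed.
End Necessity.

(** * Coordinates on a tensor square *)

Section TensorCoordinates.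
Context (k : fieldType) (A : comAlgType k) (J : eqType) (S : nat -> seq J).
Context (b : J -> A) (co : J -> {linear A -> k^o}).
Hypothesis expand : forall u : A, exists N, forall N', (N <= N')%N ->
  u = \sum_(m <- S N') (co m u : k) *: b m.

Lemma tens_suml (I : Type) (r : seq I) (F : I -> A) (v : A) :
  (\sum_(i <- r) F i) *t v = \sum_(i <- r) F i *t v.
Proof. exact: (big_morph (fun u => u *t v) (fun u u' => tensDl u u' v) (tens0l _ v)). Qed.

Lemma tens_sumr (I : Type) (r : seq I) (F : I -> A) (u : A) :
  u *t (\sum_(i <- r) F i) = \sum_(i <- r) u *t F i.
Proof. exact: (big_morph (fun v => u *t v) (tensDr u) (tens0r _ u)). Qed.

(** Coordinate forms [co] for a family [b] of [A] give coordinate forms on [A (x) A]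
    for the family of the [b m *t b n]. *)
Lemma tensor_expand (t : tensor A A) : exists N, forall N', (N <= N')%N ->
  t = \sum_(m <- S N') \sum_(n <- S N')
        (tpair (co m) (co n) t : k) *: (b m *t b n).
Proof.
elim/tensor_ind: t => [u v|t1 t2 [N1 H1] [N2 H2]].
  have [[N1 H1] [N2 H2]] := (expand u, expand v).
  exists (maxn N1 N2) => N; rewrite geq_max => /andP[/H1 Hu /H2 Hv].
  rewrite {1}Hu {1}Hv tens_suml; apply: eq_bigr => m _.
  rewrite tens_sumr; apply: eq_bigr => n _.
  by rewrite tensZl tensZr scalerA tpair_tens.
exists (maxn N1 N2) => N; rewrite geq_max => /andP[/H1 Ht1 /H2 Ht2].
rewrite {1}Ht1 {1}Ht2 -big_split; apply: eq_bigr => m _ /=.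
by rewrite -big_split; apply: eq_bigr => n _ /=; rewrite tpairD scalerDl.
Qed.
End TensorCoordinates.

Section AlternatingSum.
Context (k : fieldType) (d : nat) (V : lmodType k).

(** The skew-symmetric tensors are those of the shape required by [calI]. *)
Lemma skew_sum (C : 'I_d -> 'I_d -> k) (e : 'I_d -> 'I_d -> V) :
    (forall r : k, r = - r -> r = 0) -> (forall i j, C j i = - C i j) ->
  \sum_i \sum_j C i j *: e i j
  = \sum_(i < d) \sum_(j < d | (i < j)%N) C i j *: (e i j - e j i).
Proof.
move=> two skC.
transitivity (\sum_(i < d) (\sum_(j < d | (i < j)%N) C i j *: e i j
                      + \sum_(j < d | (j < i)%N) C i j *: e i j)).
  apply: eq_bigr => i _; rewrite (bigID (fun j : 'I_d => (i < j)%N)) /=.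
  congr (_ + _); rewrite (bigID (fun j : 'I_d => (j < i)%N)) /= addrC big1.
    rewrite add0r; apply: eq_bigl => j; rewrite -leqNgt.
    by case: (ltngtP j i).
  move=> j; rewrite -!leqNgt -eqn_leq => /eqP/val_inj->.
  by rewrite (two (C i i)) ?scale0r.
rewrite big_split /=.
have -> : \sum_(i < d) \sum_(j < d | (j < i)%N) C i j *: e i j
   = \sum_(i < d) \sum_(j < d | (i < j)%N) C j i *: e j i.
  rewrite (exchange_big_dep predT) //=.
rewrite -big_split; apply: eq_bigr => i _ /=; rewrite -big_split.
by apply: eq_bigr => j _ /=; rewrite scalerBr (skC i j) scaleNr.
Qed.
End AlternatingSum.

Section BilinearSums.
Context (R : comNzRingType) (U V W : lmodType R).

Lemma bilinD (F G : U -> V -> W) : bilin F -> bilin G ->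
  bilin (fun u v => F u v + G u v).
Proof.
move=> bF bG; split=> w r u v.
  by rewrite (bF.1 w) (bG.1 w) scalerDr addrACA.
by rewrite (bF.2 w) (bG.2 w) scalerDr addrACA.
Qed.

Lemma bilin_sum (n : nat) (F : 'I_n -> U -> V -> W) : (forall s, bilin (F s)) ->
  bilin (fun u v => \sum_s F s u v).
Proof.
move=> bF; split=> w r u v; rewrite scaler_sumr -big_split /=.
  by apply: eq_bigr => s _; rewrite ((bF s).1 w).
by apply: eq_bigr => s _; rewrite ((bF s).2 w).
Qed.
End BilinearSums.

Section ConvolutionMatrix.
Context (k : fieldType) (d : nat) (A : primhopf k d).
Local Notation x := (ph_gen A).
Local Notation Delta := (ph_comul A).
Context (L : 'I_d -> 'I_d -> conv A k^o).

(** A matrix of linear forms, as a matrix-valued linear map. *)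
Definition conv_mx (a : A) : 'M[k]_d := \matrix_(i, j) (L i j a : k).

Fact conv_mx_linear : linear conv_mx.
Proof. by move=> r a b; apply/matrixP => i j; rewrite !mxE linearP. Qed.
HB.instance Definition _ :=
  GRing.isLinear.Build k A 'M[k]_d *:%R conv_mx conv_mx_linear.

(** Condition (3), written as a sum over the comultiplication, is [jacobi_coef] in
    the convolution ring of linear forms. *)
Lemma jacobi_coef_tlift i j m a :
  tlift (W := k^o) (fun a1 a2 => \sum_(s < d)
     ((L s m a1 : k) * (L i j (x s * a2) : k) + (L s i a1 : k) * (L j m (x s * a2) : k)
      + (L s j a1 : k) * (L m i (x s * a2) : k))) (Delta a)
  = jacobi_coef L (fun s i j => shift (L i j) s) i j m a.
Proof.
rewrite conv_sumE.
transitivity (\sum_s (tpair (L s m) (shift (L i j) s) (Delta a)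
   + tpair (L s i) (shift (L j m) s) (Delta a)
   + tpair (L s j) (shift (L m i) s) (Delta a))); last by [].
set F := (fun a1 a2 => _); have bF : bilin (W := k^o) F.
  by apply: bilin_sum => s; do 2?apply: bilinD; apply: (tpair_bilin _ (shift _ _)).
elim/tensor_ind: (Delta a) => [u v|y z Hy Hz].
  by rewrite tlift_tens //; apply: eq_bigr => s _; rewrite !tpair_tens.
rewrite tliftD // Hy Hz -big_split; apply: eq_bigr => s _.
by rewrite !tpairD [LHS]addrACA [X in X + _ = _]addrACA.
Qed.
End ConvolutionMatrix.

(** * Primitive elements in characteristic zero *)

Section MulComul.
Context (k : fieldType) (d : nat) (A : primhopf k d).

(** The algebra map [mult o Delta], which doubles the generators. *)
Definition mulcomul : {lrmorphism A -> A} := tpair idfun idfun \o ph_comul A.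

Lemma mulcomul1 : mulcomul 1 = 1. Proof. exact: rmorph1. Qed.

Lemma mulcomul_genM i a : mulcomul (ph_gen A i * a) = ph_gen A i * mulcomul a *+ 2.
Proof.
rewrite rmorphM /= ph_comulX tpairD !tpair_tens /= mulr1 mul1r.
by rewrite -mulr2n mulrnAl.
Qed.
End MulComul.

Lemma eqN_eq0 (k : fieldType) : (forall n, (2 ^ n)%:R = 2%:R :> k -> n = 1%N) ->
  forall r : k, r = - r -> r = 0.
Proof.
move=> pow2_inj r rN; apply/eqP; have/eqP : 2%:R * r = 0.
  by rewrite mulr_natl mulr2n {1}rN addNr.
rewrite mulf_eq0 => /orP[/eqP r2|//].
by have := @pow2_inj 2; rewrite natrX r2 expr0n => /(_ erefl).
Qed.

Section PrimitiveDecomposition.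
Context (k : fieldType) (d : nat) (A : primhopf k d).
Local Notation x := (ph_gen A).
Local Notation Delta := (ph_comul A).
Local Notation T := (tensor A A).
Local Notation tl := (@tinl k A).
Local Notation tr := (@tinr k A).
Context (c : 'I_d -> {linear A -> k^o}).
Hypothesis c_gen : forall i j, c i (x j) = (i == j)%:R.
Context (J : eqType) (S : nat -> seq J) (b : J -> A) (co : J -> {linear A -> k^o}).
(** The forms [co] expand every element along the family [b], over all large enough
    of the finite sets [S N]; [D] is the degree of the members of [b], and those of
    degree one are generators. *)
Hypothesis expand : forall u : A, exists N, forall N', (N <= N')%N ->
  u = \sum_(m <- S N') (co m u : k) *: b m.
Context (D : J -> nat).
Hypothesis b_deg1 : forall m, D m = 1%N -> exists i, b m = x i.
Hypothesis pow2_inj : forall n, (2 ^ n)%:R = 2%:R :> k -> n = 1%N.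
Hypothesis co_mulcomul : forall m u, co m (mulcomul A u) = (2 ^ D m)%:R * (co m u : k).

(** The projection of [A] onto the span of the generators. *)
Definition proj1 (u : A) : A := \sum_i (c i u : k) *: x i.

Fact proj1_linear : linear proj1.
Proof.
move=> r u v; rewrite /proj1 scaler_sumr -big_split; apply: eq_bigr => i _ /=.
by rewrite linearP scalerDl scalerA.
Qed.
HB.instance Definition _ := GRing.isLinear.Build k A A *:%R proj1 proj1_linear.

Lemma proj1_gen i : proj1 (x i) = x i.
Proof.
rewrite /proj1 (bigD1 i) //= c_gen eqxx scale1r big1 ?addr0 // => j ne.
by rewrite c_gen (negPf ne) scale0r.
Qed.

Lemma tmap_proj1 t :
  tmap proj1 proj1 t = \sum_i \sum_j (tpair (c i) (c j) t : k) *: (x i *t x j).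
Proof.
elim/tensor_ind: t => [u v|y z Hy Hz].
  rewrite tmap_tens /= {1}/proj1 tens_suml; apply: eq_bigr => i _.
  rewrite /proj1 tens_sumr; apply: eq_bigr => j _.
  by rewrite tensZl tensZr scalerA tpair_tens.
rewrite (raddfD (tmap _ _)) /= Hy Hz -big_split; apply: eq_bigr => i _ /=.
by rewrite -big_split; apply: eq_bigr => j _ /=; rewrite tpairD scalerDl.
Qed.

(** If the members indexed by [m] and [n] of the family [b] have degrees [D m] and
    [D n], then [2 ^ D m] times the corresponding coordinate of [t] equals twice it, so
    that it vanishes unless [D m = 1]; by skew-symmetry it vanishes unless [D n = 1]
    as well. *)
Lemma primitive_decomp (t : T) : t + t2 t = 0 ->
  tpair (tpair tl tl \o Delta) tr t = t + t ->
  t = \sum_i \sum_j (tpair (c i) (c j) t : k) *: (x i *t x j).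
Proof.
move=> skt pt; rewrite -tmap_proj1.
have pt' : tmap (mulcomul A) idfun t = t + t.
  rewrite -pt; elim/tensor_ind: (t) => [u v|y z Hy Hz].
    rewrite tmap_tens tpair_tens -tinl_tinr /=; congr (_ * _).
    elim/tensor_ind: (Delta u) => [y z|y z Hy Hz].
      by rewrite !tpair_tens /= rmorphM.
    by rewrite !tpairD -Hy -Hz raddfD.
  by rewrite tpairD (raddfD (tmap _ _)) /= Hy Hz.
have degl m n : tpair (co m) (co n) t != 0 -> D m = 1%N.
  move=> nz; apply: pow2_inj; apply: (mulIf nz).
  transitivity (tpair (co m) (co n) (tmap (mulcomul A) idfun t)).
    elim/tensor_ind: (t) => [u v|y z Hy Hz].
      rewrite tmap_tens !tpair_tens co_mulcomul; exact: mulrA.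
    by rewrite (raddfD (tmap _ _)) /= !tpairD mulrDr Hy Hz.
  by rewrite pt' tpairD mulr_natl.
have degr m n : tpair (co m) (co n) t != 0 -> D n = 1%N.
  move=> nz; apply: (degl n m); rewrite -tpair_t2.
  have -> : t2 t = - t by apply/eqP; rewrite -addr_eq0 addrC; apply/eqP.
  by rewrite raddfN oppr_eq0.
have [N /(_ N (leqnn N))] := tensor_expand expand t.
set e := (X in t = X) => tE; rewrite tE /e raddf_sum; apply: eq_bigr => m _.
rewrite raddf_sum; apply: eq_bigr => n _ /=; rewrite linearZZ /=.
have [->|nz] := eqVneq (tpair (co m) (co n) t) 0; first by rewrite !scale0r.
have [i ->] := b_deg1 (degl _ _ nz); have [j ->] := b_deg1 (degr _ _ nz).
by rewrite tmap_tens /= !proj1_gen.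
Qed.

(** The theorem in the language of the convolution ring. *)
Lemma co_poisson_primhopf (q : {linear A -> T}) :
  co_poisson Delta q <->
  exists (I : conv A T) (L : 'I_d -> 'I_d -> conv A k^o),
    [/\ toconv q = I * toconv Delta,
        forall a, I a = \sum_i \sum_j (L i j a : k) *: (x i *t x j),
        forall i j, L j i = - L i j
      & forall i j m : 'I_d, (i < j)%N -> (j < m)%N ->
          jacobi_coef L (fun s i j => shift (L i j) s) i j m = 0].
Proof.
have two := eqN_eq0 pow2_inj.
split.
  move=> /co_poissonP[skq jq lq].
  exists (deconv q), (deconv_coef c q).
  have prd := primitive_decomp.
  have logE := deconvE prd skq lq.
  have sk := deconv_coef_skew c skq.
  split=> // [|i j m _ _]; first exact: deconvK.
  exact: (cojacobi_coef_eq0 c_gen logE (deconvK q)).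
move=> [I [L [qE IE skL C0]]]; apply/co_poissonP; split.
- exact: skew_q IE qE skL.
- move=> B j1 j2 j3; rewrite /cojacobi_pairing (cojacobiE IE qE skL).
  rewrite big1 ?mul0r // => i _; rewrite big1 // => j _; rewrite big1 // => m _.
  rewrite jacobi_coef_eq0 //.
  + have -> : csc B 0 = 0 :> conv A B by apply: convP => a /=; rewrite scale0r.
    by rewrite mul0r.
  + by move=> s i' j'; apply: convP => a; rewrite skL.
  by move=> f fN; apply: convP => a; apply: two; rewrite {1}fN.
by move=> B j1 j2 j3; apply: coleibniz_q IE qE skL _ _ _ _.
Qed.

Lemma conv_eq_on_basis (B : comAlgType k) (f g : conv A B) :
  (forall m, f (b m) = g (b m)) -> f = g.
Proof.
move=> fg; apply: convP => u; have [N /(_ N (leqnn N)) ->] := expand u.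
by rewrite !raddf_sum; apply: eq_bigr => m _ /=; rewrite !linearZZ /= fg.
Qed.

(** The same with [I] and lambda tested on the family [b] only. *)
Lemma co_poisson_basis (q : {linear A -> T}) :
  co_poisson Delta q <->
  exists (I : {linear A -> T}) (lambda : {linear A -> 'M[k]_d}),
    forall n : J,
      [/\ q (b n) = tlift (fun a1 a2 => I a1 * Delta a2) (Delta (b n)),
          [/\ I (b n) = \sum_(i < d) \sum_(j < d) lambda (b n) i j *: (x i *t x j),
              exists e : 'I_d -> 'I_d -> k, I (b n) =
                \sum_(i < d) \sum_(j < d | (i < j)%N)
                   e i j *: (x i *t x j - x j *t x i)
            & (lambda (b n))^T = - lambda (b n)]
        & forall i j m : 'I_d, (i < j)%N -> (j < m)%N ->
            tlift (W := k^o)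
              (fun a1 a2 => \sum_(s < d)
                 (lambda a1 s m * lambda (x s * a2) i j
                  + lambda a1 s i * lambda (x s * a2) j m
                  + lambda a1 s j * lambda (x s * a2) m i)) (Delta (b n)) = 0].
Proof.
apply: (iff_trans (co_poisson_primhopf q)).
split.
  move=> [I [L [qE IE skL C0]]].
  exists I, (conv_mx L) => n; split.
  - exact: (congr1 (fun f : conv A T => f (b n)) qE).
  - split.
    + by rewrite [LHS]IE; apply: eq_bigr => i _; apply: eq_bigr => j _; rewrite mxE.
    + exists (fun i j => L i j (b n)); rewrite [LHS]IE.
      apply: skew_sum; first exact: eqN_eq0 pow2_inj.
      by move=> i j; rewrite skL.
    + by apply/matrixP => i j; rewrite !mxE skL.
  move=> i j m ltij ltjm.
  transitivity (jacobi_coef L (fun s i j => shift (L i j) s) i j m (b n)).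
    rewrite -jacobi_coef_tlift; congr (tlift _ _).
    apply/funext => a1; apply/funext => a2; apply: eq_bigr => s _.
    by rewrite !mxE.
  by rewrite C0.
move=> [I [lambda H]].
have Llin i j : linear (fun a : A => lambda a i j : k^o).
  by move=> r a a'; rewrite linearP !mxE.
pose L i j : conv A k^o := Conv (Llin i j).
exists (toconv I), L; split.
- by apply: conv_eq_on_basis => n; have [e _ _] := H n; exact: e.
- have Ilin : linear (fun a => \sum_i \sum_j (L i j a : k) *: (x i *t x j)).
    move=> r a a'; rewrite scaler_sumr -big_split; apply: eq_bigr => i _ /=.
    rewrite scaler_sumr -big_split; apply: eq_bigr => j _ /=.
    by rewrite linearP !mxE scalerDl scalerA.
  have -> : toconv I = Conv Ilin; last by [].
  by apply: conv_eq_on_basis => n; have [_ [e _ _] _] := H n.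
- move=> i j; apply: conv_eq_on_basis => n.
  have [_ [_ _ /matrixP/(_ i j) e] _] := H n.
  by rewrite !mxE in e.
move=> i j m ltij ltjm; apply: conv_eq_on_basis => n.
have [_ _ /(_ i j m ltij ltjm) e] := H n.
by rewrite -jacobi_coef_tlift; exact: e.
Qed.
End PrimitiveDecomposition.

(** * The polynomial algebra *)

Section PolynomialInstance.
Context (k : fieldType) (d : nat).
Local Notation P := {mpoly k[d]}.

Lemma mnm_ind (Q : 'X_{1..d} -> Prop) :
  Q 0%MM -> (forall i m, Q m -> Q (U_(i) + m)%MM) -> forall m, Q m.
Proof.
move=> Q0 QS m; have [n] := ubnP (mdeg m); elim: n m => // n IHn m dm.
have [i mi|m0] := pickP (fun i => m i != 0%N); last first.
  suff -> : m = 0%MM by [].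
  by apply/mnmP => i; rewrite mnm0E; apply/eqP/negbFE/m0.
have lim : (U_(i) <= m)%MM by rewrite lep1mP.
rewrite -(submK lim) addmC; apply/QS/IHn.
by move: dm; rewrite -{1}(submK lim) mdegD mdeg1 addn1.
Qed.

Lemma mpoly_linear_eq (W : lmodType k) (f g : {linear P -> W}) :
  (forall m, f 'X_[m] = g 'X_[m]) -> f =1 g.
Proof.
move=> efg p; rewrite (mpolyE p) !raddf_sum; apply: eq_bigr => m _ /=.
by rewrite !linearZ /= efg.
Qed.

Lemma mpoly_gen_ind (Q : P -> Prop) :
    Q 1 -> (forall i a, Q a -> Q ('X_i * a)) ->
    (forall c a b, Q a -> Q b -> Q (c *: a + b)) -> forall a, Q a.
Proof.
move=> Q1 QX QD.
have Q0 : Q 0 by rewrite -(subrr 1) addrC -scaleN1r; apply: QD.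
have Qm m : Q 'X_[m].
  elim/mnm_ind: m => [|i m Qm]; first by rewrite mpolyX0.
  by rewrite mpolyXD; apply: QX.
move=> a; rewrite (mpolyE a); elim: (msupp a) => [|m s IHs].
  by rewrite big_nil.
by rewrite big_cons; apply: QD.
Qed.

(** The coefficient of a monomial, as a linear form with values in the module [k^o]. *)
Definition mcoef (m : 'X_{1..d}) (p : P) : k^o := mcoeff m p.

Fact mcoef_linear m : linear (mcoef m).
Proof. by move=> r u v; rewrite /mcoef mcoeffD mcoeffZ. Qed.
HB.instance Definition _ m :=
  GRing.isLinear.Build k P k^o *:%R (mcoef m) (mcoef_linear m).

Lemma mcoef0_1 : mcoef 0%MM 1 = 1.
Proof. by rewrite /mcoef mcoeff1 eqxx. Qed.

Lemma mcoef0_mulX i a : mcoef 0%MM ('X_i * a) = 0.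
Proof. by rewrite /mcoef rmorphM /= mcoeffX mnm1_eq0 mul0r. Qed.

(** The antipode of the polynomial Hopf algebra. *)
Definition mpoly_antipode : P -> P := comp_mpoly [tuple - 'X_i | i < d].
HB.instance Definition _ := GRing.LRMorphism.on mpoly_antipode.

Lemma mpoly_antipodeX i : mpoly_antipode 'X_i = - 'X_i.
Proof. by rewrite /mpoly_antipode /comp_mpoly mmapX mmap1U tnth_mktuple. Qed.

(** The polynomial algebra as a Hopf algebra generated by primitives. *)
Definition polyhopf : primhopf k d :=
  @PrimHopf k d P (fun i => 'X_i) (@Delta k d) (mcoef 0%MM) mpoly_antipode
    (@DeltaX k d) mcoef0_1 mcoef0_mulX mpoly_antipodeX mpoly_gen_ind.

Lemma mcoef_expand (u : P) : exists N, forall N', (N <= N')%N ->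
  u = \sum_(m <- [seq bmnm m | m : 'X_{1..d < N'}]) (mcoef m u : k) *: 'X_[m].
Proof.
exists (msize u) => N le_uN; rewrite big_image /=.
exact: mpolywE.
Qed.

Lemma mulcomul_mpolyX (m : 'X_{1..d}) :
  mulcomul polyhopf 'X_[m] = 'X_[m] *+ 2 ^ mdeg m.
Proof.
elim/mnm_ind: m => [|i m IHm].
  by rewrite mpolyX0 mdeg0; exact: mulcomul1.
rewrite mpolyXD mdegD mdeg1 expnS mulnC mulrnA -mulrnAr -IHm.
exact: mulcomul_genM.
Qed.

Lemma mcoef_mulcomul (m : 'X_{1..d}) (u : P) :
  mcoef m (mulcomul polyhopf u) = (2 ^ mdeg m)%:R * (mcoef m u : k).
Proof.
pose f := mcoef m \o (mulcomul polyhopf : {linear P -> P}).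
pose g := (2 ^ mdeg m)%:R \*: mcoef m.
have fg : f =1 g.
  apply: mpoly_linear_eq => n.
  transitivity (mcoef m ('X_[n] *+ 2 ^ mdeg n)).
    exact: (congr1 (mcoef m) (mulcomul_mpolyX n)).
  rewrite /g /= /mcoef mcoeffMn mcoeffX; have [->|_] := eqVneq n m.
    by rewrite /GRing.scale /= mulr1.
  by rewrite mul0rn scaler0.
exact: fg.
Qed.

Lemma mcoef_gen i j : mcoef U_(i)%MM 'X_j = (i == j)%:R.
Proof. by rewrite /mcoef mcoeffXU eq_sym. Qed.

Lemma mpolyX_deg1 (m : 'X_{1..d}) : mdeg m = 1%N -> exists i, 'X_[m] = 'X_i :> P.
Proof. by move=> /eqP/mdeg1P[i /eqP->]; exists i. Qed.
End PolynomialInstance.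

Section PowersOfTwo.
Context (k : fieldType) (k_char0 : [pchar k] =i pred0).

Lemma pow2_eq2 n : (2 ^ n)%:R = 2%:R :> k -> n = 1%N.
Proof.
have natr0 := (pcharf0P k).1 k_char0.
case: n => [|[|n]] //.
  by move/eqP; rewrite eq_sym -subr_eq0 -natrB // natr0.
move/eqP; rewrite -subr_eq0 -natrB; last by rewrite -[2%N]/(2 ^ 1)%N leq_exp2l.
by rewrite natr0 subn_eq0 -[X in (_ <= X)%N]/(2 ^ 1)%N leq_exp2l.
Qed.
End PowersOfTwo.

Theorem theorem4p7 (k : fieldType) (k_char0 : [pchar k] =i pred0) (d : nat)
    (q : {linear {mpoly k[d]} -> tensor {mpoly k[d]} {mpoly k[d]}}) :
  co_poisson (@Delta k d) q <->
  exists (I : {linear {mpoly k[d]} -> tensor {mpoly k[d]} {mpoly k[d]}})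
         (lambda : {linear {mpoly k[d]} -> 'M[k]_d}),
    forall a : 'X_{1..d},
      [/\ q 'X_[a] = sweedler (fun a1 a2 => I a1 * Delta a2) 'X_[a],
          [/\ I 'X_[a] =
                \sum_(i < d) \sum_(j < d) lambda 'X_[a] i j *: ('X_i *t 'X_j),
              calI (I 'X_[a])
            & (lambda 'X_[a])^T = - lambda 'X_[a]]
        & forall i j m : 'I_d, (i < j)%N -> (j < m)%N ->
            sweedler (W := k^o)
              (fun a1 a2 => \sum_(s < d)
                 (lambda a1 s m * lambda ('X_s * a2) i j
                  + lambda a1 s i * lambda ('X_s * a2) j m
                  + lambda a1 s j * lambda ('X_s * a2) m i)) 'X_[a] = 0].
Proof.
exact (@co_poisson_basis k d (polyhopf k d) (fun i => mcoef U_(i)%MM) (@mcoef_gen k d)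
  'X_{1..d} (fun N => [seq bmnm m | m : 'X_{1..d < N}]) (fun m => 'X_[m]) (@mcoef k d)
  (@mcoef_expand k d) (@mdeg d) (@mpolyX_deg1 k d) (pow2_eq2 k_char0)
  (@mcoef_mulcomul k d) q).
Qed.
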